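(* Let $d\ge 2$. Let $P$ be the Power Spherical distribution on $\mathbb{S}^{d-1}$ with direction $\mu_p\in\mathbb{S}^{d-1}$ and concentration $\kappa_p\ge 0$, and let $Q$ be the von Mises-Fisher distribution on $\mathbb{S}^{d-1}$ with direction $\mu_q\in\mathbb{S}^{d-1}$ and concentration $\kappa_q\ge 0$. With $\alpha=\frac{d-1}{2}+\kappa_p$ and $\beta=\frac{d-1}{2}$, $$\mathrm{D_{KL}}[P\|Q] = -\operatorname{H}(P) + \log C_X(\kappa_q,d) - \kappa_q\,\mu_q^\top\mu_p\left(\frac{\alpha-\beta}{\alpha+\beta}\right),$$ where $\operatorname{H}(P)$ is the differential entropy of $P$.
   Context: $\mathbb{S}^{d-1}=\{x\in\mathbb{R}^d:\|x\|_2=1\}$ with surface measure $\sigma$. The Power Spherical distribution with direction $\mu$ and concentration $\kappa$ has density w.r.t. $\sigma$ proportional to $(1+\mu^\top x)^\kappa$. The von Mises-Fisher distribution with direction $\mu_q$ and concentration $\kappa_q$ has density $q(x) = C_X(\kappa_q,d)^{-1}\exp(\kappa_q\mu_q^\top x)$ w.r.t. $\sigma$, where $C_X(\kappa_q,d)=\int_{\mathbb{S}^{d-1}}\exp(\kappa_q\mu_q^\top x)\,d\sigma(x)$ is its normalizer. $\operatorname{H}(P) = -\mathbb{E}_{p}[\log p]$ and $\mathrm{D_{KL}}[P\|Q] = -\operatorname{H}(P) - \mathbb{E}_{p}[\log q]$. *)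

(* Defs.v *)
From HB Require Import structures.
From mathcomp Require Import all_boot all_order all_algebra.
From mathcomp Require Import all_classical all_reals all_analysis.
Set Implicit Arguments. Unset Strict Implicit. Unset Printing Implicit Defensive.
Import Order.TTheory GRing.Theory Num.Theory.
Import numFieldNormedType.Exports.
Local Open Scope classical_set_scope.
Local Open Scope ring_scope.

Section sphere.
Variable R : realType.

Definition dotp (d : nat) (u v : d.-tuple R) : R :=
  \sum_(i < d) tnth u i * tnth v i.

Definition enorm (d : nat) (x : d.-tuple R) : R := Num.sqrt (dotp x x).

Definition unit_sphere (d : nat) : set (d.-tuple R) := [set x | enorm x = 1].

Definition normalize (d : nat) (x : d.-tuple R) : d.-tuple R :=
  map_tuple (fun a => a / enorm x) x.

(* Lebesgue integral over R^d, written as the iterated Lebesgue integral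
   \int dx_1 ... \int dx_d f(x_1,...,x_d) (equal to the integral against the
   d-dimensional Lebesgue measure for integrable / nonnegative measurable f,
   by Fubini-Tonelli). *)
Fixpoint lebesgue_int (n : nat) : (n.-tuple R -> \bar R) -> \bar R :=
  match n return (n.-tuple R -> \bar R) -> \bar R with
  | 0 => fun f => f [tuple]
  | n'.+1 => fun f =>
      (\int[@lebesgue_measure R]_x lebesgue_int (fun t => f (cons_tuple x t)))%E
  end.

(* Integral over S^{d-1} against the surface measure sigma, defined through
   the polar-coordinates identity
     \int_{S^{d-1}} g dsigma = d * \int_{0 < |x| <= 1} g (x / |x|) dx
   (sigma = d times the Lebesgue measure of the cone {r x | 0 < r <= 1}). *)
Definition sphere_int (d : nat) (g : d.-tuple R -> R) : \bar R :=
  (d%:R%:E * lebesgue_int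
     (fun x : d.-tuple R =>
        if ((0 < enorm x) && (enorm x <= 1))%R then (g (normalize x))%:E else 0%E))%E.

Definition ps_normalizer (d : nat) (mu : d.-tuple R) (kappa : R) : R :=
  fine (sphere_int (fun x => (1 + dotp mu x) `^ kappa)).

Definition ps_density (d : nat) (mu : d.-tuple R) (kappa : R) (x : d.-tuple R) : R :=
  (1 + dotp mu x) `^ kappa / ps_normalizer mu kappa.

Definition vmf_normalizer (d : nat) (mu : d.-tuple R) (kappa : R) : R :=
  fine (sphere_int (fun x => expR (kappa * dotp mu x))).

Definition vmf_density (d : nat) (mu : d.-tuple R) (kappa : R) (x : d.-tuple R) : R :=
  expR (kappa * dotp mu x) / vmf_normalizer mu kappa.

Definition entropy (d : nat) (p : d.-tuple R -> R) : \bar R :=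
  (- sphere_int (fun x => (p x * ln (p x))%R))%E.

Definition kl_div (d : nat) (p q : d.-tuple R -> R) : \bar R :=
  sphere_int (fun x => p x * (ln (p x) - ln (q x))).

End sphere.

(* Main.v *)
(* Since ln q = kappa_q mu_q.x - ln C_X, the identity reduces to the normalization
   of p and to the first moment E_p[x] = kappa / (d - 1 + kappa) mu_p.  Rotation
   invariance of Lebesgue measure reduces the moment to mu_p = e_0, and slicing
   the ball along x_0 = s |(x_1, ..., x_{d-1})| turns integrals of functions of
   x_0 over the sphere into one-dimensional integrals against rho(s)^d ds, where
   t = s rho(s) and rho(s) = (1 + s^2)^(-1/2).  There
     kappa int (1 + t)^kappa (1 - t) rho^d = (d - 1) int (1 + t)^kappa t rho^d,
   because the difference of the integrands is the derivative of
   (1 + t)^kappa rho^(d-1), which vanishes at both ends. *)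
Require Import Defs.
From HB Require Import structures.
From mathcomp Require Import all_boot all_order all_algebra.
From mathcomp Require Import all_classical all_reals all_analysis.
From mathcomp Require Import measurable_realfun ring lra.
Set Implicit Arguments. Unset Strict Implicit. Unset Printing Implicit Defensive.
Import Order.TTheory GRing.Theory Num.Theory.
Import numFieldNormedType.Exports.
Local Open Scope classical_set_scope.
Local Open Scope ring_scope.

(** [lebesgue_int] is an iterated integral, not an integral against a measure, so linearity,
    monotonicity and exchange of variables do not come with it. It is therefore identified with
    integration against a measure on tuples, for nonnegative measurable functions and for bounded
    functions supported in a cube; the second class covers the signed integrands of the entropy and
    of the first moment. Rotation invariance and slicing are Tonelli arguments, hence stated for
    nonnegative integrands. Signed quantities are accordingly traded for nonnegative ones: a
    constant is added to the product of [v] with [x], the weight [1 - t] replaces [t], and a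
    multiple of [(1 + s ^+ 2)^-1] is added before the fundamental theorem of calculus is applied on
    the whole line. The constant of the slicing formula is never evaluated, as it multiplies both
    sides of the moment identity. The second direction [mu_q] is carried through the rotation along
    with [mu_p], and a reflection removes its part orthogonal to [mu_p]. *)

Definition pushforward_measure d1 d2 (T1 : measurableType d1)
    (T2 : measurableType d2) (R : realType) (m : {measure set T1 -> \bar R})
    (phi : T1 -> T2) (mphi : measurable_fun setT phi) :
  {measure set T2 -> \bar R}.
Proof. by refine [the {measure set T2 -> \bar R} of pushforward m phi]. Defined.

(** * Affine changes of variable on the line *)

Section affine.
Variable R : realType.
Local Notation mR := (measurableTypeR R).
Local Notation leb := (@lebesgue_measure R).
Local Open Scope ereal_scope.

Let affine (c e : R) : mR -> mR := fun x => (c * x + e)%R.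

Let measurable_affine (c e : R) : measurable_fun setT (affine c e).
Proof. by apply: measurable_funD => //; exact: measurable_funM. Qed.

(** The rescaled pushforward agrees with Lebesgue measure on half-open intervals, and uniqueness of
    Lebesgue measure does the rest. *)
Lemma lebesgue_measure_affine (c e : R) (A : set mR) : c != 0%R -> measurable A ->
  leb A = `|c|%:E * pushforward leb (affine c e) A.
Proof.
move=> c0 mA.
pose m' : {measure set mR -> \bar R} :=
  mscale (NngNum (normr_ge0 c)) (pushforward_measure leb (measurable_affine c e)).
rewrite (lebesgue_measure_unique (mu := m')) //.
move=> _ [[a b]] _ <-; rewrite /m' /mscale /= /pushforward.
rewrite lebesgue_measure_itv /=.
transitivity (`|c|%:E * leb (affine c e @^-1` `]a, b])); last by [].
have [cp|cn|/eqP] := ltgtP c 0%R; last by rewrite (negbTE c0).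
(* A negative slope swaps the endpoints, so the closed end moves to the left; the length is
   unaffected. *)
- have pre : affine c e @^-1` `]a, b] = `[((b - e) / c)%R, ((a - e) / c)%R[%classic.
    apply/seteqP; split => x /=; rewrite !in_itv/= /affine ler_ndivrMr// ltr_ndivlMr//;
    rewrite ltrBlDr lerBrDr mulrC; lra.
  rewrite pre.
  rewrite lebesgue_measure_itv /= !lte_fin.
  rewrite ltr_nM2r ?invr_lt0// ltrD2r.
  case: ifPn => _; last by rewrite mule0.
  by rewrite -!EFinB -EFinM ltr0_norm//; congr EFin; field.
- have pre : affine c e @^-1` `]a, b] = `]((a - e) / c)%R, ((b - e) / c)%R]%classic.
    apply/seteqP; split => x /=; rewrite !in_itv/= /affine ler_pdivlMr// ltr_pdivrMr//;
    rewrite ltrBlDr lerBrDr mulrC; lra.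
  rewrite pre.
  rewrite lebesgue_measure_itv /= !lte_fin.
  rewrite ltr_pM2r ?invr_gt0// ltrD2r.
  case: ifPn => _; last by rewrite mule0.
  by rewrite -!EFinB -EFinM gtr0_norm//; congr EFin; field; rewrite gt_eqF.
Qed.

Lemma ge0_integral_affine (c e : R) (f : mR -> \bar R) : c != 0%R ->
  measurable_fun setT f -> (forall x, 0 <= f x) ->
  \int[leb]_x f x = `|c|%:E * \int[leb]_x f (c * x + e)%R.
Proof.
move=> c0 mf f0.
pose m' : {measure set mR -> \bar R} :=
  mscale (NngNum (normr_ge0 c)) (pushforward_measure leb (measurable_affine c e)).
rewrite (eq_measure_integral m'); last first.
  by move=> A mA _; exact: (lebesgue_measure_affine e c0 mA).
by rewrite /m' ge0_integral_mscale// ge0_integral_pushforward// => y _; exact: f0.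
Qed.

End affine.

(** * Rotations of the plane *)

Section rotation.
Variable R : realType.
Local Notation mR := (measurableTypeR R).
Local Notation leb := (@lebesgue_measure R).
Local Open Scope ereal_scope.

(* For b <> 0, a rotation is two affine changes of one variable at a time, with
   an exchange of the order of integration in between. *)
Lemma ge0_integral_rotation (a b : R) (f : mR * mR -> \bar R) :
  (a ^+ 2 + b ^+ 2 = 1)%R -> measurable_fun setT f -> (forall x, 0 <= f x) ->
  \int[leb]_x \int[leb]_y f (a * x + b * y, - b * x + a * y)%R =
  \int[leb]_x \int[leb]_y f (x, y).
Proof.
move=> ab1 mf f0.
have mf1 g x : measurable_fun setT g -> measurable_fun setT (fun y : mR => f (x, g y)).
  by move=> mg; apply: measurableT_comp => //; exact: measurable_fun_pair.
have [b0|b0] := eqVneq b 0%R.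
  have a1 : (`|a| = 1)%R.
    by apply/eqP; rewrite -sqrp_eq1// real_normK ?num_real//; apply/eqP; rewrite -ab1 b0; ring.
  have a0 : a != 0%R by rewrite -normr_eq0 a1 oner_neq0.
  rewrite [RHS](ge0_integral_affine 0%R a0); last 2 first.
    exact: measurable_fun_fubini_tonelli_F.
    by move=> x; exact: integral_ge0.
  rewrite a1 mul1e; apply: eq_integral => x _.
  rewrite [RHS](ge0_integral_affine 0%R a0) ?a1 ?mul1e//; last exact: mf1.
  by apply: eq_integral => y _; congr (f (_, _)); rewrite b0; ring.
have Nb0 : (- b)%R != 0%R by rewrite oppr_eq0.
(* With [x] fixed, [u = a * x + b * y] replaces [y]; since [a ^+ 2 + b ^+ 2 = 1], the second
   coordinate becomes [(a * u - x) / b]. *)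
transitivity (\int[leb]_x (`|b^-1|%:E * \int[leb]_u f (u, (a * u - x) / b)%R)).
  apply: eq_integral => x _.
  rewrite [in RHS](ge0_integral_affine (a * x)%R b0); last 2 first.
  - apply: measurableT_comp => //; apply: measurable_fun_pair => //.
    apply: measurable_funM => //; apply: measurable_funD => //; exact: measurable_funM.
  - by move=> ?; exact: f0.
  rewrite muleA -EFinM -normrM mulVf// normr1 mul1e; apply: eq_integral => y _.
  congr (f (_, _)); first by ring.
  have -> : (- b * x + a * y = (- b ^+ 2 * x + a * b * y) / b)%R by field.
  have b2 : (b ^+ 2 = 1 - a ^+ 2)%R by rewrite -ab1; ring.
  by congr (_ / _)%R; rewrite b2; ring.
pose g (p : mR * mR) := f (p.2, (a * p.2 - p.1) / b)%R.
have g0 p : 0 <= g p by exact: f0.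
have mg : measurable_fun setT g.
  apply: measurableT_comp => //; apply: measurable_fun_pair => //.
  apply: measurable_funM => //; apply: measurable_funB => //; exact: measurable_funM.
rewrite ge0_integralZl//; last 2 first.
- exact: (measurable_fun_fubini_tonelli_F g).
- by move=> x _; exact: integral_ge0.
rewrite (fubini_tonelli g)//=.
rewrite -ge0_integralZl//; last 2 first.
- exact: (measurable_fun_fubini_tonelli_G g).
- by move=> x _; exact: integral_ge0.
apply: eq_integral => u _.
(* With [u] fixed, [x = a * u - b * w] turns the second coordinate into [w]; the Jacobians of the
   two substitutions cancel. *)
rewrite (ge0_integral_affine (a * u)%R Nb0)//; last first.
  apply: (mf1 (fun x => (a * u - x) / b)%R); apply: measurable_funM => //.
  by apply: measurable_funB.
rewrite muleA -EFinM -normrM mulrN mulVf// normrN1 mul1e.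
by apply: eq_integral => w _; congr (f (_, _)) => /=; field.
Qed.

End rotation.

Lemma integrable_of_bounded d (T : measurableType d) (R : realType)
    (m : {measure set T -> \bar R}) (C : set T) (f : T -> R) (M : R) :
  measurable C -> (m C < +oo)%E -> measurable_fun setT f ->
  (forall x, `|f x| <= if x \in C then M else 0) ->
  m.-integrable setT (EFin \o f).
Proof.
move=> mC Coo mf fM.
rewrite (_ : EFin \o f = (EFin \o f) \_ C); last first.
  apply/funext => x; rewrite patchE; case: ifPn => // xC /=.
  by have := fM x; rewrite (negbTE xC) normr_le0 => /eqP ->.
apply/(integrable_mkcond _ mC)/measurable_bounded_integrable => //.
  exact: measurable_funS mf.
exists M; split; first exact: num_real.
move=> z Mz x /mem_set xC; have := fM x; rewrite xC => h.
exact: le_trans h (ltW Mz).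
Qed.

(** * The iterated integral as an integral against a measure *)

Section tuple_measure.
Variable R : realType.
Local Notation mR := (measurableTypeR R).
Local Notation leb := (@lebesgue_measure R).
Local Open Scope ereal_scope.

Definition in_cube n (x : n.-tuple mR) : bool := all (fun a : R => (`|a| <= 1)%R) x.

(** A cube rather than a ball: its slices along the first coordinate are empty or again the unit
    cube, so the property passes to slices in an induction on the dimension. *)
Definition bounded_in_cube n (f : n.-tuple mR -> R) : Prop :=
  measurable_fun setT f /\
  exists M : R, forall x, (`|f x| <= if in_cube x then M else 0)%R.

(** The interface between iterated integrals and measure theory: Tonelli, Fubini, and finite mass of
    the cube, which makes the bounded functions integrable. *)
Definition lebesgue_spec n (m : {measure set (n.-tuple mR) -> \bar R}) : Prop :=
  [/\ forall f : n.-tuple mR -> \bar R, measurable_fun setT f -> (forall x, 0 <= f x) ->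
        @lebesgue_int R n f = \int[m]_x f x,
      forall f, bounded_in_cube f ->
        @lebesgue_int R n (EFin \o f) = \int[m]_x (f x)%:E &
      m [set` in_cube (n := n)] < +oo].

Let cons n (p : mR * n.-tuple mR) : n.+1.-tuple mR := cons_tuple p.1 p.2.

Let measurable_cons n : measurable_fun setT (@cons n).
Proof.
exact: (@measurable_function.measurable_cons _ _ _ _ fst n snd).
Qed.

Let uncons n (t : n.+1.-tuple mR) : mR * n.-tuple mR :=
  (tnth t ord0, behead_tuple t).

Let measurable_uncons n : measurable_fun setT (@uncons n).
Proof.
apply: measurable_fun_pair; first exact: measurable_tnth.
exact: measurable_behead.
Qed.

Let consK n : cancel (@cons n) (@uncons n).
Proof. by move=> [x t]; congr pair; exact: val_inj. Qed.

Lemma measurable_in_cube n : measurable [set` in_cube (n := n)].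
Proof.
have -> : [set` in_cube (n := n)] = \bigcap_(i in [set: 'I_n]) ((fun x : n.-tuple mR => tnth x i) @^-1` [set a : mR | (`|a| <= 1)%R]).
  apply/seteqP; split => x /=.
    by move=> /all_tnthP h i _; exact: h.
  by move=> h; apply/all_tnthP => i; exact: h.
apply: fin_bigcap_measurable => // i _.
rewrite -[X in measurable X]setTI; apply: measurable_tnth => //.
rewrite -[X in measurable X]setTI.
have := @normr_measurable R setT measurableT _ (measurable_itv `]-oo, 1%R]).
by congr measurable; apply/seteqP; split => a /=; rewrite in_itv/=.
Qed.

Section cons_measure.
Variables (n : nat) (m : {sigma_finite_measure set (n.-tuple mR) -> \bar R}).

Definition cons_measure : set (n.+1.-tuple mR) -> \bar R :=
  pushforward_measure (leb \x m) (@measurable_cons n).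

HB.instance Definition _ := Measure.on cons_measure.

Let cons_measure_sigma_finite : sigma_finite setT cons_measure.
Proof.
have /sigma_finiteP[F [TF ndF Foo]] := sigma_finiteT leb.
have /sigma_finiteP[G [TG ndG Goo]] := sigma_finiteT m.
exists (fun k => @uncons n @^-1` (F k `*` G k)).
  rewrite -preimage_bigcup (_ : \bigcup_k _ = setT) ?preimage_setT//.
  apply/seteqP; split => // -[x y] _.
  have [i _ Fx] : (\bigcup_k F k) x by rewrite -TF.
  have [j _ Gy] : (\bigcup_k G k) y by rewrite -TG.
  exists (maxn i j) => //; split.
    by move: x Fx; exact/subsetPset/ndF/leq_maxl.
  by move: y Gy; exact/subsetPset/ndG/leq_maxr.
move=> k; have [mF Fk] := Foo k; have [mG Gk] := Goo k; split.
  by rewrite -[X in measurable X]setTI; apply: measurable_uncons => //; exact: measurableX.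
rewrite (_ : cons_measure _ = (leb \x m) (F k `*` G k)).
  by rewrite product_measure1E// lte_mul_pinfty// ge0_fin_numE.
rewrite /cons_measure /= /pushforward; congr product_measure1.
by apply/funext => p; rewrite -[in RHS](consK p).
Qed.

HB.instance Definition _ := Measure_isSigmaFinite.Build _ _ _ cons_measure
  cons_measure_sigma_finite.

End cons_measure.

(** Induction from the Dirac mass at the empty tuple. [cons_measure] transports the product measure;
    the first clause is then Tonelli and the second Fubini. Sigma-finiteness is kept in the
    statement because the next product requires it. *)
Lemma lebesgue_spec_exists n :
  exists m : {sigma_finite_measure set (n.-tuple mR) -> \bar R}, lebesgue_spec m.
Proof.
elim: n => [|n [m [mE1 mE2 mE3]]].
  exists [the {sigma_finite_measure set _ -> \bar R} of \d_([tuple] : 0.-tuple mR)].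
  split => [f mf f0|f [mf _]|/=].
  - by rewrite integral_dirac// diracT mul1e.
  - by rewrite integral_dirac ?diracT ?mul1e//; exact/measurable_EFinP.
  - by rewrite diracE; case: (_ \in _); rewrite ltry.
pose m' := [the {sigma_finite_measure set (n.+1.-tuple mR) -> \bar R} of cons_measure m].
exists m'.
have E1 (f : n.+1.-tuple mR -> \bar R) : measurable_fun setT f -> (forall x, 0 <= f x) ->
    @lebesgue_int R n.+1 f = \int[m']_x f x.
  move=> mf f0.
  rewrite (ge0_integral_pushforward (@measurable_cons n))//= preimage_setT.
  have mfc : measurable_fun setT (f \o @cons n).
    exact: (measurableT_comp mf (@measurable_cons n)).
  rewrite fubini_tonelli1//=.
  apply: eq_integral => x _; rewrite mE1//.
  exact: (measurableT_comp mfc (pair1_measurable x)).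
have E3 : m' [set` in_cube (n := n.+1)] < +oo.
  rewrite (_ : m' _ = (leb \x m) (`[(-1)%R, 1%R]%classic `*` [set` in_cube (n := n)])).
  rewrite product_measure1E//; last exact: measurable_in_cube.
    have leboo : leb `[(-1)%R, 1%R] < +oo.
      by rewrite lebesgue_measure_itv/=; case: ifP; rewrite // ltry.
    by rewrite lte_mul_pinfty// ge0_fin_numE.
  rewrite /m' /= /cons_measure /= /pushforward; congr product_measure1.
  apply/seteqP; split => [[x t]|[x t]] /=; rewrite in_itv/= /in_cube/= -ler_norml.
    by move=> /andP[].
  by move=> [h1 h2]; apply/andP; split.
split => // f [mf [M fM]].
have mfc : measurable_fun setT (f \o @cons n).
    exact: (measurableT_comp mf (@measurable_cons n)).
have intf : (leb \x m).-integrable setT (EFin \o (f \o @cons n)).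
  apply: (@integrable_of_bounded _ _ _ (leb \x m)%E (@cons n @^-1` [set` in_cube (n := n.+1)]) _ M) => //.
    by rewrite -[X in measurable X]setTI; apply: measurable_cons => //; exact: measurable_in_cube.
  by move=> p; apply: le_trans (fM (cons p)) _; rewrite mem_setE.
rewrite (integral_pushforward (@measurable_cons n))//= ?preimage_setT//; last exact/measurable_EFinP.
rewrite -integral12_prod_meas1//=.
apply: eq_integral => x _; rewrite mE2//; split.
  exact: (measurableT_comp mfc (pair1_measurable x)).
(* The absolute value matters when [|x| > 1]: the slice is then zero, and its bound must still be
   nonnegative. *)
exists `|M|%R => t; apply: (le_trans (fM (cons_tuple x t))).
rewrite /in_cube/=; case: (`|x| <= 1)%R => /=; case: ifP => // _; exact: ler_norm.
Qed.
End tuple_measure.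

(** Syntax-directed measurability for polynomial expressions in the components of nested pairs;
    other subterms, such as [dotp], are left as goals. *)
Ltac meas1 :=
  first [ exact: measurable_cst | exact: measurable_id | exact: measurable_fst
  | exact: measurable_snd | assumption
  | match goal with
    | |- measurable_fun _ (fun p => (@?f p, @?g p)) => apply: measurable_fun_pair
    | |- measurable_fun _ (fun p => GRing.mul (@?f p) (@?g p)) => apply: measurable_funM
    | |- measurable_fun _ (fun p => GRing.exp (@?f p) _) => apply: measurable_funX
    | |- measurable_fun _ (fun p => GRing.add (@?f p) (GRing.opp (@?g p))) => apply: measurable_funB
    | |- measurable_fun _ (fun p => GRing.opp (@?g p)) => apply: measurable_funN
    | |- measurable_fun _ (fun p => Algebra.opp (@?g p)) => apply: measurable_funN
    | |- measurable_fun _ (fun p => GRing.add (@?f p) (@?g p)) => apply: measurable_funD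
    | |- measurable_fun _ (fun p => Algebra.add (@?f p) (@?g p)) => apply: measurable_funD
    | |- measurable_fun _ (fun p => fst (@?g p)) => apply: (measurableT_comp measurable_fst)
    | |- measurable_fun _ (fun p => snd (@?g p)) => apply: (measurableT_comp measurable_snd)
    end ].
Ltac meas := repeat meas1.

(** * Rotation invariance of the iterated integral *)

Section lebesgue_int_theory.
Variable R : realType.
Local Notation mR := (measurableTypeR R).
Local Notation leb := (@lebesgue_measure R).
Local Open Scope ereal_scope.

Definition lebesgue_tuple n : {sigma_finite_measure set (n.-tuple mR) -> \bar R} :=
  sval (cid (@lebesgue_spec_exists R n)).

Lemma ge0_lebesgue_intE n (f : n.-tuple mR -> \bar R) :
  measurable_fun setT f -> (forall x, 0 <= f x) ->
  @lebesgue_int R n f = \int[lebesgue_tuple n]_x f x.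
Proof. by rewrite /lebesgue_tuple; case: cid => m mP /=; have [h _ _] := mP; exact: h. Qed.

Lemma bounded_lebesgue_intE n (f : n.-tuple mR -> R) : bounded_in_cube f ->
  @lebesgue_int R n (EFin \o f) = \int[lebesgue_tuple n]_x (f x)%:E.
Proof. by rewrite /lebesgue_tuple; case: cid => m mP /=; have [_ h _] := mP; exact: h. Qed.

Lemma lebesgue_tuple_cube n : lebesgue_tuple n [set` in_cube (n := n)] < +oo.
Proof. by rewrite /lebesgue_tuple; case: cid => m mP /=; have [_ _] := mP. Qed.

Lemma lebesgue_intS n (f : n.+1.-tuple R -> \bar R) :
  lebesgue_int f = \int[leb]_x lebesgue_int (fun t => f (cons_tuple x t)).
Proof. by []. Qed.

Lemma lebesgue_int_ge0 n (f : n.-tuple R -> \bar R) :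
  (forall x, 0 <= f x) -> 0 <= lebesgue_int f.
Proof.
elim: n f => [|n IH] f f0 /=; first exact: f0.
by apply: integral_ge0 => x _; exact: IH.
Qed.

Lemma eq_lebesgue_int n (f g : n.-tuple R -> \bar R) :
  f =1 g -> lebesgue_int f = lebesgue_int g.
Proof. by move=> /funext ->. Qed.

Lemma measurable_lebesgue_int d (T : measurableType d) n
    (f : T * n.-tuple mR -> \bar R) :
  measurable_fun setT f -> (forall x, 0 <= f x) ->
  measurable_fun setT (fun t => @lebesgue_int R n (fun x => f (t, x))).
Proof.
move=> mf f0.
rewrite (_ : (fun t => _) = fun t => \int[lebesgue_tuple n]_x f (t, x)).
  exact: measurable_fun_fubini_tonelli_F.
apply/funext => t; rewrite ge0_lebesgue_intE//.
exact: (measurableT_comp mf (pair1_measurable t)).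
Qed.

Lemma measurable_dotp d (T : measurableType d) n (f g : T -> n.-tuple mR) :
  measurable_fun setT f -> measurable_fun setT g ->
  measurable_fun setT (fun t => dotp (f t) (g t) : mR).
Proof.
move=> mf mg; apply: measurable_sum => i.
by apply: measurable_funM; apply: (measurableT_comp (measurable_tnth i)).
Qed.

Lemma dotp_cons n (a b : R) (u w : n.-tuple R) :
  dotp (cons_tuple a u) (cons_tuple b w) = (a * b + dotp u w)%R.
Proof.
rewrite /dotp big_ord_recl !tnth0; congr (_ + _)%R.
by apply: eq_bigr => i _; rewrite !tnthS.
Qed.

Lemma dotp0 (u w : 0.-tuple R) : dotp u w = 0%R.
Proof. by rewrite /dotp big_ord0. Qed.

Lemma dotp_ge0 n (u : n.-tuple R) : (0 <= dotp u u)%R.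
Proof. by apply: sumr_ge0 => i _; rewrite -expr2 sqr_ge0. Qed.

Lemma dotpC n (u w : n.-tuple R) : dotp u w = dotp w u.
Proof. by apply: eq_bigr => i _; rewrite mulrC. Qed.

Definition scalet n (c : R) (u : n.-tuple R) : n.-tuple R := map_tuple ( *%R c) u.

Lemma dotp_scalel n (c : R) (u w : n.-tuple R) : dotp (scalet c u) w = (c * dotp u w)%R.
Proof. by rewrite /dotp mulr_sumr; apply: eq_bigr => i _; rewrite tnth_map mulrA. Qed.

Lemma dotp_scaler n (c : R) (u w : n.-tuple R) : dotp u (scalet c w) = (c * dotp u w)%R.
Proof. by rewrite dotpC dotp_scalel dotpC. Qed.

Lemma dotp_eq0 n (u w : n.-tuple R) : dotp u u = 0%R -> dotp u w = 0%R.
Proof.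
move=> /eqP; rewrite psumr_eq0 => [/allP h|i _]; last by rewrite -expr2 sqr_ge0.
apply: big1 => i _; have := h i (mem_index_enum i).
by rewrite -expr2 sqrf_eq0 => /eqP ->; rewrite mul0r.
Qed.

(** The tail of a unit vector need not be a unit vector, yet the induction on the dimension has to
    continue with one. For a zero tail any unit vector serves, its coefficient being 0. *)
Lemma unit_direction n (u : n.+1.-tuple R) :
  exists nu, dotp nu nu = 1%R /\ forall w, dotp u w = (enorm u * dotp nu w)%R.
Proof.
have [u0|u0] := eqVneq (dotp u u) 0%R.
  exists (cons_tuple 1%R (nseq_tuple n 0%R)); split.
    rewrite dotp_cons mul1r (_ : dotp _ _ = 0%R) ?addr0//.
    by apply: big1 => i _; rewrite tnth_nseq mul0r.
  by move=> w; rewrite dotp_eq0// /enorm u0 sqrtr0 mul0r.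
have e0 : enorm u != 0%R.
  by rewrite sqrtr_eq0 -ltNge lt_neqAle eq_sym u0 dotp_ge0.
exists (scalet (enorm u)^-1 u); split.
  rewrite dotp_scalel dotp_scaler mulrA -expr2 exprVn sqr_sqrtr ?dotp_ge0//.
  by rewrite mulVf.
by move=> w; rewrite dotp_scalel mulrA divff// mul1r.
Qed.

Lemma sqrD_eq0 (a b : R) : (a ^+ 2 + b ^+ 2 = 0 -> a = 0 /\ b = 0)%R.
Proof.
by move=> /eqP; rewrite paddr_eq0 ?sqr_ge0// !sqrf_eq0 => /andP[/eqP -> /eqP ->].
Qed.

(* Slice off the first coordinate x: by induction the remaining coordinates can
   be rotated so that mu and v only involve y_0 and (y_0, y_1); a rotation of
   the (x, y_0) plane and then one of the (w, y_1) plane finish. *)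
Lemma lebesgue_int_rotation (n : nat) (mu v : n.+2.-tuple R) :
  dotp mu mu = 1%R ->
  exists be : R, forall H : mR * mR * mR -> \bar R,
    measurable_fun setT H -> (forall p, 0 <= H p) ->
    lebesgue_int (fun x => H (dotp mu x, dotp v x, dotp x x)) =
    \int[leb]_x \int[leb]_y @lebesgue_int R n (fun z =>
      H (x, dotp v mu * x + be * y, x ^+ 2 + y ^+ 2 + dotp z z)%R).
Proof.
elim: n mu v => [|n IH] mu v mu1.
  case/tupleP: mu mu1 => a mu; case/tupleP: mu => b mu.
  case/tupleP: v => v1 v; case/tupleP: v => v2 v.
  rewrite !dotp_cons !dotp0 => ab1.
  (* The component of [v] along [(- b, a)], the unit normal to [mu = (a, b)]. *)
  exists (a * v2 - b * v1)%R => H mH H0 /=.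
  pose f (p : mR * mR) := H (p.1, (v1 * a + v2 * b) * p.1 + (a * v2 - b * v1) * p.2, p.1 ^+ 2 + p.2 ^+ 2)%R.
  have ab : (a ^+ 2 + b ^+ 2 = 1)%R by rewrite -ab1; ring.
  transitivity (\int[leb]_x \int[leb]_y f (x, y)).
    rewrite -(ge0_integral_rotation ab); last 2 first.
    - by rewrite /f; apply: (measurableT_comp mH); meas.
    - by move=> p; exact: H0.
    apply: eq_integral => x _; apply: eq_integral => y _; rewrite /f/= !dotp_cons !dotp0.
    have a2 : (a ^+ 2 = 1 - b ^+ 2)%R by rewrite -ab; ring.
    by congr (H (_, _, _)); ring: a2.
  by apply: eq_integral => x _; apply: eq_integral => y _; rewrite /f/= !dotp0 !addr0.
case/tupleP: mu mu1 => a mu; case/tupleP: v => v1 v.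
rewrite !dotp_cons => ab1.
have [nu [nu1 munu]] := unit_direction mu.
set b := enorm mu in munu.
have b2 : dotp mu mu = (b ^+ 2)%R by rewrite sqr_sqrtr// dotp_ge0.
have ab : (a ^+ 2 + b ^+ 2 = 1)%R by rewrite -ab1 b2; ring.
have [be' IH'] := IH nu v nu1.
have -> : dotp v mu = (b * dotp v nu)%R by rewrite dotpC munu dotpC.
set al' := dotp v nu in IH' *.
(* Once [mu] is turned onto the [x] axis, [v] has coefficients [al], [be0], [be'] on [x], [y], [w];
   the second rotation merges the last two into their length [be]. *)
pose be0 := (a * al' - b * v1)%R.
pose al := (v1 * a + b * al')%R.
pose be := Num.sqrt (be0 ^+ 2 + be' ^+ 2).
exists be => H mH H0.
transitivity (\int[leb]_x \int[leb]_y \int[leb]_w @lebesgue_int R n (fun z =>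
   H (a * x + b * y, v1 * x + (al' * y + be' * w), x ^+ 2 + (y ^+ 2 + w ^+ 2 + dotp z z))%R)).
  rewrite lebesgue_intS; apply: eq_integral => x _.
  rewrite -(IH' (fun p => H (a * x + b * p.1.1, v1 * x + p.1.2, x ^+ 2 + p.2)%R)).
  - apply: eq_lebesgue_int => y; rewrite !dotp_cons munu.
    by congr (H (_, _, _)); ring.
  - by apply: (measurableT_comp mH); meas.
  - by move=> p; exact: H0.
pose f1 (p : mR * mR) := \int[leb]_w @lebesgue_int R n (fun z =>
   H (p.1, al * p.1 + (be0 * p.2 + be' * w), p.1 ^+ 2 + (p.2 ^+ 2 + w ^+ 2 + dotp z z))%R).
transitivity (\int[leb]_x \int[leb]_y f1 (x, y)).
  rewrite -(ge0_integral_rotation ab); last 2 first.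
  - pose g (p : mR * mR * mR * n.-tuple mR) :=
      H (p.1.1.1, al * p.1.1.1 + (be0 * p.1.1.2 + be' * p.1.2),
         p.1.1.1 ^+ 2 + (p.1.1.2 ^+ 2 + p.1.2 ^+ 2 + dotp p.2 p.2))%R.
    have g0 p : 0 <= g p by exact: H0.
    have mg : measurable_fun setT g.
      by apply: (measurableT_comp mH); meas; apply: measurable_dotp; meas.
    apply: (measurable_fun_fubini_tonelli_F (fun q => @lebesgue_int R n (fun z => g (q, z)))).
      exact: measurable_lebesgue_int.
    by move=> q; exact: lebesgue_int_ge0.
  - by move=> p; apply: integral_ge0 => w _; apply: lebesgue_int_ge0 => z; exact: H0.
  apply: eq_integral => x _; apply: eq_integral => y _; apply: eq_integral => w _.
  apply: eq_lebesgue_int => z; rewrite /al /be0/=.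
  have a2 : (a ^+ 2 = 1 - b ^+ 2)%R by rewrite -ab; ring.
  by congr (H (_, _, _)); ring: a2.
apply: eq_integral => x _.
pose f2 (p : mR * mR) := @lebesgue_int R n (fun z =>
  H (x, al * x + be * p.1, x ^+ 2 + (p.1 ^+ 2 + p.2 ^+ 2 + dotp z z))%R).
transitivity (\int[leb]_y \int[leb]_w f2 (y, w)); last first.
  apply: eq_integral => y _; rewrite lebesgue_intS.
  apply: eq_integral => w _; apply: eq_lebesgue_int => z.
  by rewrite dotp_cons; congr (H (_, _, _)) => /=; rewrite /al; ring.
have bebe : (be ^+ 2 = be0 ^+ 2 + be' ^+ 2)%R.
  by rewrite sqr_sqrtr// addr_ge0// sqr_ge0.
(* If the length is 0 there is no angle to rotate by, but the two integrands already coincide. *)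
have [be_0|be_0] := eqVneq be 0%R.
  have /sqrD_eq0[b00 b'0] : (be0 ^+ 2 + be' ^+ 2 = 0)%R.
    by rewrite -bebe be_0 expr0n.
  apply: eq_integral => y _; rewrite /f1/f2 /= b00 b'0 be_0.
  apply: eq_integral => w _; apply: eq_lebesgue_int => z.
  by congr (H (_, _, _)); ring.
have be1 : ((be0 / be) ^+ 2 + (be' / be) ^+ 2 = 1)%R.
  by rewrite !expr_div_n -mulrDl -bebe divff// sqrf_eq0.
rewrite -(ge0_integral_rotation be1); last 2 first.
- pose g (p : mR * mR * n.-tuple mR) := H (x, al * x + be * p.1.1, x ^+ 2 + (p.1.1 ^+ 2 + p.1.2 ^+ 2 + dotp p.2 p.2))%R.
  apply: (measurable_lebesgue_int (f := g)).
    by apply: (measurableT_comp mH); meas; apply: measurable_dotp; meas.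
  by move=> p; exact: H0.
- by move=> p; apply: lebesgue_int_ge0 => z; exact: H0.
apply: eq_integral => y _; apply: eq_integral => w _; apply: eq_lebesgue_int => z /=.
congr (H (_, _, _)); first by field.
have -> : (y ^+ 2 + w ^+ 2 = (be ^+ 2) / be ^+ 2 * (y ^+ 2 + w ^+ 2))%R by field.
by rewrite {1}bebe; field.
Qed.
End lebesgue_int_theory.

(** * Measurability of the maps that define sphere integrals *)

Section sphere_measurability.
Variable R : realType.
Local Notation mR := (measurableTypeR R).

(** Inversion is discontinuous at 0, where its value is 0 by convention; the product form used here
    is measurable and takes the same value there. *)
Lemma measurable_invr : measurable_fun setT (fun x : mR => x^-1 : mR).
Proof.
rewrite (_ : (fun x => _) = fun x : R => x * (x ^+ 2) `^ (-1)).
  apply: measurable_funM => //.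
  by apply: (measurableT_comp (measurable_powR (-1))); exact: measurable_funX.
apply/funext => x; rewrite powR_inv1 ?sqr_ge0//.
have [->|x0] := eqVneq x 0; first by rewrite invr0 mul0r.
by field.
Qed.

Lemma measurable_sqrtr : measurable_fun setT (@Num.sqrt R : mR -> mR).
Proof. exact: continuous_measurable_fun (@sqrt_continuous R). Qed.

Lemma measurable_funV d (T : measurableType d) (f : T -> mR) :
  measurable_fun setT f -> measurable_fun setT (fun x => (f x)^-1 : mR).
Proof. by move=> mf; exact: (measurableT_comp measurable_invr). Qed.

Lemma measurable_enorm d (T : measurableType d) n (f : T -> n.-tuple mR) :
  measurable_fun setT f -> measurable_fun setT (fun t => enorm (f t) : mR).
Proof.
by move=> mf; apply: (measurableT_comp measurable_sqrtr); exact: measurable_dotp.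
Qed.

Lemma measurable_normalize n : measurable_fun setT (@normalize R n : n.-tuple mR -> n.-tuple mR).
Proof.
apply/measurable_fun_tnthP => i.
rewrite (_ : _ \o _ = fun x : n.-tuple mR => tnth x i / enorm x).
  apply: measurable_funM; first exact: measurable_tnth.
  by apply: measurable_funV; exact: measurable_enorm.
by apply/funext => x; rewrite /= tnth_map.
Qed.

(** Meant for a norm [r]: the condition in [sphere_int], which excludes the origin because
    [normalize] has no direction to return there. *)
Definition in_ball (r : R) : bool := (0 < r) && (r <= 1).

Lemma measurable_in_ball d (T : measurableType d) (f : T -> mR) :
  measurable_fun setT f -> measurable_fun setT (fun x => in_ball (f x)).
Proof.
move=> mf; apply: measurable_and; first exact: measurable_fun_ltr.
exact: measurable_fun_ler.
Qed.

End sphere_measurability.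

(** * One-dimensional integrals over the half circle *)

Section real_line.
Variable R : realType.
Local Notation mR := (measurableTypeR R).
Local Notation leb := (@lebesgue_measure R).

(* (tau s, rho s) is the point of the upper half circle on the ray through
   (s, 1), so that rho = sqrt (1 - tau ^ 2). *)
Definition rho (s : R) : R := (Num.sqrt (1 + s ^+ 2))^-1.
Definition tau (s : R) : R := s * rho s.

Lemma rho_gt0 s : 0 < rho s.
Proof. by rewrite invr_gt0 sqrtr_gt0 ltr_wpDr// sqr_ge0. Qed.

Lemma rho2E s : rho s ^+ 2 = (1 + s ^+ 2)^-1.
Proof. by rewrite exprVn sqr_sqrtr// addr_ge0// sqr_ge0. Qed.

Lemma rho2D s : rho s ^+ 2 * (1 + s ^+ 2) = 1.
Proof. by rewrite rho2E mulVf// gt_eqF// ltr_wpDr// sqr_ge0. Qed.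

Lemma rho_le1 s : rho s <= 1.
Proof.
rewrite -(@ler_pXn2r _ 2)// ?nnegrE ?(ltW (rho_gt0 s))// expr1n.
by have := rho2D s; have := sqr_ge0 s; have := sqr_ge0 (rho s); nra.
Qed.

Lemma tau2 s : tau s ^+ 2 = 1 - rho s ^+ 2.
Proof. by have := rho2D s; rewrite /tau; lra. Qed.

Lemma tau_itv s : -1 < tau s < 1.
Proof.
have := rho_gt0 s; have := tau2 s.
by move=> h1 h2; apply/andP; split; nra.
Qed.

Lemma is_derive_rho (s : R) : is_derive s 1 rho (- s * rho s ^+ 3).
Proof.
have s1 : 0 < 1 + s ^+ 2 by rewrite ltr_wpDr// sqr_ge0.
have q0 : Num.sqrt (1 + s ^+ 2) != 0 by rewrite gt_eqF// sqrtr_gt0.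
have d1 : is_derive s 1 (fun s : R => 1 + s ^+ 2) (2 * s).
  by apply: is_derive_eq; rewrite /GRing.scale/=; ring.
have d2 : is_derive s 1 (fun s => Num.sqrt (1 + s ^+ 2)) ((2 * Num.sqrt (1 + s ^+ 2))^-1 * (2 * s)).
  exact: (@is_derive1_comp _ Num.sqrt (fun s : R => 1 + s ^+ 2) s _ _ (is_derive1_sqrt s1) d1).
have d3 := @is_deriveV _ (fun s : R => Num.sqrt (1 + s ^+ 2)) s _ 1 q0 d2.
apply: (@is_derive_eq _ _ _ _ _ _ _ _ d3).
rewrite /GRing.scale/= /rho; field; exact: q0.
Qed.

Lemma is_derive_tau (s : R) : is_derive s 1 tau (rho s ^+ 3).
Proof.
have d := is_derive_rho s.
apply: is_derive_eq; rewrite /GRing.scale /= mulr1.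
have := rho2D s => h.
transitivity (rho s * (rho s ^+ 2 * (1 + s ^+ 2) - rho s ^+ 2 * s ^+ 2)); last by ring.
by rewrite h; ring.
Qed.

Lemma integral_derive_line (f F : R -> R) (l1 l2 : R) :
  (forall x, 0 <= f x) -> continuous f -> (forall x : R, is_derive x 1 F (f x)) ->
  F x @[x --> -oo] --> l1 -> F x @[x --> +oo] --> l2 ->
  (\int[leb]_x (f x)%:E = (l2 - l1)%:E)%E.
Proof.
move=> f0 cf dF F1 F2.
have mf : measurable_fun setT f by exact: continuous_measurable_fun.
have cF : continuous F.
  by move=> x; apply/differentiable_continuous/derivable1_diffP; exact: ex_derive.
have Tsplit : [set: R] = `]-oo, 0]%classic `|` `]0, +oo[%classic.
  apply/seteqP; split => x //= _; rewrite !in_itv/= andbT.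
  by case: (leP x 0); [left|right].
have mE (A : set R) : measurable_fun A (EFin \o f) by exact/measurable_EFinP/measurable_funTS.
rewrite Tsplit ge0_integral_setU//=; last 3 first.
- exact: mE.
- by move=> x _; rewrite lee_fin.
- by apply/disj_set2P; rewrite -subset0 => x /=; rewrite !in_itv/= andbT leNgt => -[/negP].
rewrite integral_itv_obnd_cbnd; last exact: mE.
rewrite (@ge0_continuous_FTC2y _ f F 0 l2)//; last 3 first.
- exact: continuous_subspaceT.
- by apply: cvg_at_right_filter; exact: cF.
- by move=> x _; rewrite derive1E; exact: derive_val.
have -> : (\int[leb]_(x in `]-oo, 0%R]) (f x)%:E = (F 0)%:E - l1%:E)%E.
  (* The left half-line is reflected onto [[0, +oo[]; [G] is the antiderivative of the reflected
     integrand, with limit [- l1]. *)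
  pose G x := - F (- x).
  pose fN x := f (- x).
  have dG (x : R) : is_derive x 1 G (f (- x)).
    have := dF (- x) => dFx.
    by apply: is_derive_eq; rewrite /GRing.scale/=; ring.
  transitivity (\int[leb]_(x in `[0%R, +oo[) (fN x)%:E)%E.
    rewrite (ge0_integration_by_substitution0 (f := fun x => (fN x)%:E))//=.
      by apply: eq_integral => x _; rewrite /fN opprK.
      by apply/measurable_EFinP; apply: measurableT_comp.
    by move=> r; rewrite lee_fin; exact: f0.
  rewrite (@ge0_continuous_FTC2y _ fN G 0 (- l1))//.
  - by rewrite /G oppr0 -!EFinB; congr EFin; ring.
  - by move=> x _; exact: f0.
  - apply: continuous_subspaceT => x; apply: continuous_comp; last exact: cf.
    exact: opp_continuous.
  - by apply: cvgN; move/cvgNy_compNP : F1.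
  - apply: cvg_at_right_filter.
    by apply/differentiable_continuous/derivable1_diffP; exact: ex_derive.
  - by move=> x _; rewrite derive1E; exact: derive_val.
by rewrite -!EFinB -EFinD; congr EFin; ring.
Qed.

Lemma integral_oneDsqrV_line : (\int[leb]_x ((1 + x ^+ 2)^-1)%:E = pi%:E)%E.
Proof.
rewrite (@integral_derive_line _ atan (- (pi / 2)) (pi / 2)).
- by congr EFin; lra.
- by move=> x; rewrite invr_ge0 addr_ge0// sqr_ge0.
- exact: continuous_oneDsqrV.
- apply/cvgNy_compNP; rewrite (_ : _ \o _ = \- atan); first by apply: cvgN; exact: cvgy_atan.
  by apply/funext => x /=; rewrite atanN.
- exact: cvgy_atan.
Qed.

Section beta_identity.
Variables (k : R) (n : nat).
Hypothesis k0 : 0 <= k.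

(** Here [n] is [d - 2]. The derivative [g] of [G] is written as the difference of the two
    integrands to be compared. *)
Let G s := (1 + tau s) `^ k * rho s ^+ n.+1.
Let g s := k * ((1 + tau s) `^ k * (1 - tau s)) * rho s ^+ n.+2
  - n.+1%:R * ((1 + tau s) `^ k * tau s) * rho s ^+ n.+2.

Let is_derive_G (s : R) : is_derive s 1 G (g s).
Proof.
have /andP[t1 t2] := tau_itv s.
have t0 : 0 < 1 + tau s by lra.
have d := is_derive_rho s.
have d1 : is_derive s 1 (fun s => 1 + tau s) (rho s ^+ 3).
  have d' := is_derive_tau s.
  by apply: is_derive_eq; rewrite /GRing.scale/=; ring.
have d2 : is_derive s 1 (fun s => (1 + tau s) `^ k) (k * (1 + tau s) `^ (k - 1) * rho s ^+ 3).
  exact: (@is_derive1_comp _ (@powR R ^~ k) (fun s => 1 + tau s) s _ _ (is_derive1_powR k t0) d1).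
have d4 := is_deriveM d2 (is_deriveX n.+1 d).
rewrite (_ : G = (fun s => (1 + tau s) `^ k) * rho ^+ n.+1); last first.
  by apply/funext => x; rewrite /G mulrfctE exprfctE.
move: d4; congr is_derive.
rewrite /GRing.scale /= /g exprfctE.
have -> : (1 + tau s) `^ k = (1 + tau s) `^ (k - 1) * (1 + tau s).
  rewrite -{3}(powRr1 (ltW t0)) -powRD ?subrK//.
  by rewrite (gt_eqF t0) implybT.
set P := (1 + tau s) `^ (k - 1).
(* The square of [rho] is [(1 - tau) * (1 + tau)]: its second factor restores the exponent lowered
   by differentiating the power. *)
have e3 : rho s ^+ 3 = rho s * (1 - tau s ^+ 2) by rewrite tau2; ring.
have -> : rho s ^+ n.+1 * (k * P * rho s ^+ 3) = k * P * (1 - tau s ^+ 2) * rho s ^+ n.+2.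
  by rewrite e3 !exprS; ring.
rewrite /tau !exprS; ring.
Qed.

Let powR_tau_le s : (1 + tau s) `^ k <= 2 `^ k.
Proof.
have /andP[t1 t2] := tau_itv s.
by apply: ge0_ler_powR; rewrite ?nnegrE//; lra.
Qed.

(** On the half circle the power of [1 + tau] is at most 2^k and [rho s ^+ n.+2] is at most
    [rho s ^+ 2], so [C * rho s ^+ 2] dominates the term subtracted in [g]. *)
Let C := n.+1%:R * 2 `^ k : R.

Let C0 : 0 <= C.
Proof. by rewrite mulr_ge0// powR_ge0. Qed.

Let continuous_rho : continuous rho.
Proof.
by move=> x; apply/differentiable_continuous/derivable1_diffP;
  have := is_derive_rho x => d; exact: ex_derive.
Qed.

Let continuous_rhoX m : continuous (fun s => rho s ^+ m).
Proof.
by move=> x; apply: (@continuous_comp _ _ _ rho (fun y => y ^+ m));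
  [exact: continuous_rho|exact: exprn_continuous].
Qed.

Let continuous_tau : continuous tau.
Proof.
by move=> x; apply/differentiable_continuous/derivable1_diffP;
  have := is_derive_tau x => d; exact: ex_derive.
Qed.

Let continuous_powR_tau : continuous (fun s => (1 + tau s) `^ k).
Proof.
move=> x; apply/differentiable_continuous/derivable1_diffP.
have /andP[t1 t2] := tau_itv x.
have t0 : 0 < 1 + tau x by lra.
have d1 : is_derive x 1 (fun s => 1 + tau s) (rho x ^+ 3).
  have d' := is_derive_tau x.
  by apply: is_derive_eq; rewrite /GRing.scale/=; ring.
have d := @is_derive1_comp _ (@powR R ^~ k) (fun s => 1 + tau s) x _ _ (is_derive1_powR k t0) d1.
exact: ex_derive.
Qed.

Let oneDsqrV_rho s : (1 + s ^+ 2)^-1 = rho s ^+ 2. Proof. by rewrite rho2E. Qed.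

(* C is chosen so that f >= 0, which the improper-integral FTC requires. *)
Let f s := g s + C * (1 + s ^+ 2)^-1.

Let f_ge0 s : 0 <= f s.
Proof.
rewrite /f /g oneDsqrV_rho.
have /andP[t1 t2] := tau_itv s.
have P0 : 0 <= (1 + tau s) `^ k by rewrite powR_ge0.
have P1 := powR_tau_le s.
have r0 := rho_gt0 s; have r1 := rho_le1 s.
have rn : rho s ^+ n.+2 <= rho s ^+ 2 by rewrite ler_wiXn2l// ltW.
have rn0 : 0 <= rho s ^+ n.+2 by rewrite exprn_ge0// ltW.
have h1 : 0 <= k * ((1 + tau s) `^ k * (1 - tau s)) * rho s ^+ n.+2.
  by rewrite mulr_ge0// mulr_ge0// mulr_ge0// subr_ge0 ltW.
have h2 : (1 + tau s) `^ k * tau s * rho s ^+ n.+2 <= 2 `^ k * rho s ^+ 2.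
  apply: (@le_trans _ _ ((1 + tau s) `^ k * rho s ^+ n.+2)).
    by rewrite ler_wpM2r// ler_piMr// ltW.
  by apply: ler_pM.
have h3 : n.+1%:R * ((1 + tau s) `^ k * tau s * rho s ^+ n.+2) <= n.+1%:R * (2 `^ k * rho s ^+ 2).
  by rewrite ler_wpM2l.
by rewrite /C; lra.
Qed.

Let continuous_g : continuous g.
Proof.
move=> x; rewrite /g; apply: cvgB; apply: cvgM.
- apply: cvgM; first exact: cvg_cst.
  apply: cvgM; first exact: continuous_powR_tau.
  by apply: cvgB; [exact: cvg_cst|exact: continuous_tau].
- exact: continuous_rhoX.
- apply: cvgM; first exact: cvg_cst.
  by apply: cvgM; [exact: continuous_powR_tau|exact: continuous_tau].
- exact: continuous_rhoX.
Qed.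

(** Because [rho x] is at most [1 / |x|]. A general filter treats both ends of the line at once. *)
Let cvg_rho (F : set_system R) {FF : ProperFilter F} : `|x| @[x --> F] --> +oo -> rho x @[x --> F] --> 0.
Proof.
move=> Foo; apply/cvgrPdist_le => e e0.
have /cvgryPge/(_ e^-1) := Foo; apply: filterS => x xe.
rewrite sub0r normrN gtr0_norm ?rho_gt0// /rho -(invrK e) lef_pV2 ?posrE ?invr_gt0 ?sqrtr_gt0//; last first.
  by rewrite ltr_wpDr// sqr_ge0.
apply: (le_trans xe); rewrite -sqrtr_sqr ler_sqrt ?lerDr//.
by rewrite addr_ge0// sqr_ge0.
Qed.

Let cvg_G (F : set_system R) {FF : ProperFilter F} : `|x| @[x --> F] --> +oo -> G x @[x --> F] --> 0.
Proof.
move=> Foo; apply: (@squeeze_cvgr _ _ _ _ (fun=> 0) (fun x => 2 `^ k * rho x)).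
- apply: nearW => x; rewrite /G mulr_ge0 ?powR_ge0 ?exprn_ge0 ?(ltW (rho_gt0 x))//=.
  apply: ler_pM => //; rewrite ?powR_ge0 ?exprn_ge0 ?(ltW (rho_gt0 x))//.
  by rewrite -[leRHS]expr1 ler_wiXn2l// ?rho_le1// ltW// rho_gt0.
- exact: cvg_cst.
- rewrite -[X in _ --> X](mulr0 (2 `^ k)); apply: cvgM; first exact: cvg_cst.
  exact: cvg_rho.
Qed.

Let cvg_normy : `|x| @[x --> (+oo : set_system R)] --> +oo.
Proof.
apply/cvgryPge => A; near=> x; apply: le_trans (ler_norm _).
by near: x; apply: nbhs_pinfty_ge; exact: num_real.
Unshelve. all: by end_near. Qed.

Let cvg_normNy : `|x| @[x --> (-oo : set_system R)] --> +oo.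
Proof.
apply/cvgNy_compNP; rewrite (_ : _ \o _ = fun x => `|x|); first exact: cvg_normy.
by apply/funext => x /=; rewrite normrN.
Qed.

Let continuous_f : continuous f.
Proof.
move=> x; apply: cvgD; first exact: continuous_g.
by apply: cvgM; [exact: cvg_cst|exact: continuous_oneDsqrV].
Qed.

(** [G] vanishes at both ends, so only the arctangent that integrates the added term contributes. *)
Let integral_f : (\int[leb]_x (f x)%:E = (C * pi)%:E)%E.
Proof.
have dF (x : R) : is_derive x 1 (fun x => G x + C * atan x) (f x).
  have dG := is_derive_G x; have da := is_derive1_atan x.
  by apply: is_derive_eq; rewrite /GRing.scale/= /f; ring.
have FN : (G x + C * atan x) @[x --> -oo] --> C * - (pi / 2).
  rewrite -[X in _ --> X]add0r; apply: cvgD; first exact: cvg_G cvg_normNy.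
  apply: cvgM; first exact: cvg_cst.
  apply/cvgNy_compNP; rewrite (_ : _ \o _ = \- atan).
    by apply: cvgN; exact: cvgy_atan.
  by apply/funext => x /=; rewrite atanN.
have FP : (G x + C * atan x) @[x --> +oo] --> C * (pi / 2).
  rewrite -[X in _ --> X]add0r; apply: cvgD; first exact: cvg_G cvg_normy.
  by apply: cvgM; [exact: cvg_cst|exact: cvgy_atan].
rewrite (integral_derive_line f_ge0 continuous_f dF FN FP).
by congr EFin; lra.
Qed.

Local Open Scope ereal_scope.

(** The vanishing integral of [g], with [n.+1] times the integral carrying [1 - tau] added to both
    sides: both integrands become nonnegative, so additivity holds in the extended reals. *)
Lemma beta_identity :
  (k + n.+1%:R)%:E * \int[leb]_s ((1 + tau s) `^ k * (1 - tau s) * rho s ^+ n.+2)%:E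
  = (n.+1%:R)%:E * \int[leb]_s ((1 + tau s) `^ k * rho s ^+ n.+2)%:E.
Proof.
pose A s : R := ((1 + tau s) `^ k * (1 - tau s) * rho s ^+ n.+2)%R.
pose Z s : R := ((1 + tau s) `^ k * rho s ^+ n.+2)%R.
have A0 s : (0 <= A s)%R.
  have /andP[_ t2] := tau_itv s.
  rewrite /A mulr_ge0 ?exprn_ge0 ?(ltW (rho_gt0 s))// mulr_ge0 ?powR_ge0//.
  by rewrite subr_ge0 ltW.
have Z0 s : (0 <= Z s)%R.
  by rewrite /Z mulr_ge0 ?powR_ge0 ?exprn_ge0 ?(ltW (rho_gt0 s)).
have mrho : measurable_fun setT (rho : mR -> mR) by exact: continuous_measurable_fun.
have mtau : measurable_fun setT (tau : mR -> mR) by exact: continuous_measurable_fun.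
have mp : measurable_fun setT ((fun s => ((1 + tau s) `^ k)%R) : mR -> mR) by exact: continuous_measurable_fun.
have mA : measurable_fun setT (A : mR -> mR) by rewrite /A; meas.
have mZ : measurable_fun setT (Z : mR -> mR) by rewrite /Z; meas.
have mf : measurable_fun setT (f : mR -> mR).
  exact: continuous_measurable_fun.
have mo : measurable_fun setT ((fun x => (1 + x ^+ 2)^-1)%R : mR -> mR).
  by apply: continuous_measurable_fun; exact: continuous_oneDsqrV.
have o0 (x : R) : (0 <= (1 + x ^+ 2)^-1)%R by rewrite invr_ge0 addr_ge0// sqr_ge0.
have kn0 : (0 <= k + n.+1%:R)%R by rewrite addr_ge0.
have E : \int[leb]_s (((k + n.+1%:R) * A s)%:E + (C * (1 + s ^+ 2)^-1)%:E) =
         \int[leb]_s ((f s)%:E + (n.+1%:R * Z s)%:E).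
  apply: eq_integral => s _; rewrite -!EFinD; congr EFin.
  by rewrite /f /g /A /Z; ring.
have mE (u : mR -> mR) : measurable_fun setT u -> measurable_fun setT (fun x => (u x)%:E).
  by move=> mu; exact/measurable_EFinP.
have intZl (c : R) (u : mR -> R) : (0 <= c)%R -> (forall x, 0 <= u x)%R -> measurable_fun setT (u : mR -> mR) ->
    \int[leb]_s (c * u s)%:E = c%:E * \int[leb]_s (u s)%:E.
  move=> c0 u0 mu; under eq_integral do rewrite EFinM.
  rewrite ge0_integralZl//; first exact: mE.
  by move=> x _; rewrite lee_fin.
move: E; rewrite !ge0_integralD//; last 7 first.
all: try by apply: mE; meas.
all: try by move=> x _; rewrite lee_fin ?f_ge0// mulr_ge0.
rewrite integral_f !intZl// integral_oneDsqrV_line -EFinM addeC.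
(* Being finite, [C * pi] can be cancelled in the extended reals. *)
move=> /(congr1 (fun x => x - (C * pi)%:E)).
by rewrite ![(C * pi)%:E + _]addeC !addeK.
Qed.

End beta_identity.
End real_line.

(** * Slicing the ball: integrals of functions of one coordinate *)

Section zonal.
Variable R : realType.
Local Notation mR := (measurableTypeR R).
Local Notation leb := (@lebesgue_measure R).
Local Open Scope ereal_scope.

Lemma enorm_cons n (a : R) (x : n.-tuple R) :
  enorm (cons_tuple a x) = Num.sqrt (a ^+ 2 + dotp x x).
Proof. by rewrite /enorm dotp_cons. Qed.

Lemma enorm_ge0 n (x : n.-tuple R) : (0 <= enorm x)%R.
Proof. exact: sqrtr_ge0. Qed.

Lemma enorm2 n (x : n.-tuple R) : (enorm x ^+ 2 = dotp x x)%R.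
Proof. by rewrite sqr_sqrtr// dotp_ge0. Qed.

Lemma measurable_scalet n (c : R) : measurable_fun setT (@scalet R n c : n.-tuple mR -> n.-tuple mR).
Proof.
apply/measurable_fun_tnthP => i.
rewrite (_ : _ \o _ = fun x : n.-tuple mR => (c * tnth x i)%R).
  by apply: measurable_funM => //; exact: measurable_tnth.
by apply/funext => x; rewrite /= tnth_map.
Qed.

Lemma lebesgue_int_scale n (c : R) (F : n.-tuple mR -> \bar R) : (0 < c)%R ->
  measurable_fun setT F -> (forall x, 0 <= F x) ->
  @lebesgue_int R n F = (c ^+ n)%:E * @lebesgue_int R n (fun x => F (scalet c x)).
Proof.
move=> c0; elim: n F => [|n IH] F mF F0.
  by rewrite /= expr0 mul1e; congr F; exact/val_inj.
have mFc : measurable_fun setT (fun p : mR * n.-tuple mR => F (cons_tuple p.1 p.2)).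
  exact: (measurableT_comp mF (@measurable_function.measurable_cons _ _ _ _ fst n snd _ _)).
rewrite !lebesgue_intS.
have -> : \int[leb]_x @lebesgue_int R n (fun t => F (cons_tuple x t)) =
  \int[leb]_x ((c ^+ n)%:E * @lebesgue_int R n (fun t => F (cons_tuple x (scalet c t)))).
  apply: eq_integral => x _; rewrite (IH (fun t => F (cons_tuple x t)))//.
  exact: (measurableT_comp mFc (pair1_measurable x)).
pose F2 (p : mR * n.-tuple mR) := F (cons_tuple p.1 (scalet c p.2)).
have mF2 : measurable_fun setT F2.
  apply: (measurableT_comp mFc (g := fun p => (p.1, scalet c p.2))).
  by meas; apply: (measurableT_comp (@measurable_scalet n c)); meas.
have F20 p : 0 <= F2 p by exact: F0.
have mL := measurable_lebesgue_int mF2 F20.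
rewrite ge0_integralZl//; last 2 first.
- by move=> x _; exact: lebesgue_int_ge0.
- by rewrite lee_fin exprn_ge0// ltW.
rewrite (ge0_integral_affine 0%R (lt0r_neq0 c0) mL); last first.
  by move=> x; exact: lebesgue_int_ge0.
rewrite muleA -EFinM (gtr0_norm c0) -exprSr; congr (_ * _).
apply: eq_integral => x _; apply: eq_lebesgue_int => t.
by rewrite /F2/= addr0; congr F; exact/val_inj.
Qed.

Lemma measurable_rho : measurable_fun setT (@rho R : mR -> mR).
Proof.
apply: measurable_funV; apply: (measurableT_comp (@measurable_sqrtr R)).
by apply: measurable_funD => //; exact: measurable_funX.
Qed.

Lemma measurable_tau : measurable_fun setT (@tau R : mR -> mR).
Proof. by apply: measurable_funM => //; exact: measurable_rho. Qed.

Lemma measurable_origin n : measurable [set y : n.-tuple mR | dotp y y = 0%R].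
Proof.
have md : measurable_fun setT (fun y : n.-tuple mR => dotp y y : mR).
  exact: measurable_dotp.
by rewrite -[X in measurable X]setTI; exact: (md measurableT [set 0%R] (measurable_set1 0%R)).
Qed.

(** Discards [y = 0], where the substitution [x_0 = s |y|] degenerates. The slice integral vanishes
    unless the first coordinate is 0, a null set of the line; this uses that the dimension is at
    least 1. *)
Lemma lebesgue_tuple_origin n :
  lebesgue_tuple R n.+1 [set y | dotp y y = 0%R] = 0.
Proof.
set N := [set y | _].
have mN : measurable N by exact: measurable_origin.
rewrite -[N]setIT -integral_indic// -ge0_lebesgue_intE//; last first.
  by apply/measurable_EFinP; exact: measurable_indic.
rewrite lebesgue_intS.
set phi := fun x => lebesgue_int _.
have phi0 : phi = phi \_ [set 0%R].
  apply/funext => x; rewrite patchE; case: ifPn => // x0.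
  rewrite /phi (_ : (fun t => _) = cst 0).
    elim: (n) => [//|m IH] /=; rewrite -/(lebesgue_int _).
    by apply: integral0_eq => y _; exact: IH.
  apply/funext => t /=; congr EFin; rewrite indicE memNset// /N /= dotp_cons.
  move=> /eqP; rewrite paddr_eq0 ?dotp_ge0 -?expr2 ?sqr_ge0// sqrf_eq0.
  by move=> /andP[/eqP x0' _]; move: x0; rewrite x0' mem_set.
by rewrite phi0 -integral_mkcond integral_set1.
Qed.

(** The integrand [enorm y] is the Jacobian of [x_0 = s |y|], integrated over the ball of the
    remaining coordinates. *)
Definition zonal_constant n : \bar R :=
  @lebesgue_int R n (fun y => (if in_ball (enorm y) then enorm y else 0%R)%:E).

(* Substituting x_0 = s |y| for fixed y = (x_1, ..., x_d) makes both x_0 / |x|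
   and |x| / |y| functions of s alone. *)
Lemma sphere_int_zonal n (h : mR -> mR) : measurable_fun setT h ->
  (forall t, -1 <= t <= 1 -> 0 <= h t)%R ->
  sphere_int (fun x : n.+2.-tuple R => h (tnth x ord0)) =
  (n.+2%:R)%:E * (zonal_constant n.+1 * \int[leb]_s (h (tau s) * rho s ^+ n.+2)%:E).
Proof.
move=> mh h0; rewrite /sphere_int; congr (_ * _).
pose m := lebesgue_tuple R n.+1.
pose nm (p : mR * n.+1.-tuple mR) : R := Num.sqrt (p.1 ^+ 2 + dotp p.2 p.2).
pose f (p : mR * n.+1.-tuple mR) : \bar R :=
  (if in_ball (nm p) then h (p.1 / nm p)%R else 0%R)%:E.
have mnm : measurable_fun setT (nm : _ -> mR).
  apply: (measurableT_comp (@measurable_sqrtr R)); meas.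
  by apply: measurable_dotp; meas.
have mf : measurable_fun setT f.
  apply/measurable_EFinP; apply: measurable_fun_ifT; [exact: measurable_in_ball| |exact: measurable_cst].
  apply: (measurableT_comp mh); apply: measurable_funM; first by meas.
  exact: measurable_funV.
have nm_le p : (`|p.1| <= nm p)%R.
  by rewrite -sqrtr_sqr ler_sqrt ?lerDl ?addr_ge0 ?sqr_ge0 ?dotp_ge0.
have f0 p : 0 <= f p.
  rewrite lee_fin; case: ifPn => // /andP[n0 _]; apply: h0.
  by rewrite -ler_norml normrM normfV (gtr0_norm n0) ler_pdivrMr// mul1r.
have mfx x : measurable_fun setT (fun y => f (x, y)).
  exact: (measurableT_comp mf (pair1_measurable x)).
have mfy y : measurable_fun setT (fun x => f (x, y)).
  exact: (measurableT_comp mf (pair2_measurable y)).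
transitivity (\int[leb]_x \int[m]_y f (x, y)).
  rewrite lebesgue_intS; apply: eq_integral => x _.
  rewrite -ge0_lebesgue_intE//; apply: eq_lebesgue_int => y.
  by rewrite tnth_map tnth0 enorm_cons /f /nm /in_ball/=; case: ifP.
rewrite fubini_tonelli//.
pose F2 (p : n.+1.-tuple mR * mR) : \bar R :=
  (enorm p.1)%:E * f (p.2 * enorm p.1, p.1)%R.
have mF2 : measurable_fun setT F2.
  apply: emeasurable_funM; first by apply/measurable_EFinP; apply: measurable_enorm; meas.
  apply: (measurableT_comp mf (g := fun p : n.+1.-tuple mR * mR => (p.2 * enorm p.1, p.1)%R)).
  by meas; apply: measurable_enorm; meas.
have F20 p : 0 <= F2 p by rewrite mule_ge0// lee_fin enorm_ge0.
transitivity (\int[m]_y \int[leb]_s F2 (y, s)).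
  apply: ge0_ae_eq_integral => //.
  - exact: (measurable_fun_fubini_tonelli_G f).
  - exact: (measurable_fun_fubini_tonelli_F F2).
  - by move=> y _; exact: integral_ge0.
  - by move=> y _; exact: integral_ge0.
  exists [set y | dotp y y = 0%R]; split; [exact: measurable_origin|exact: lebesgue_tuple_origin|].
  move=> y /= ny; apply: contrapT => y0; apply: ny => _.
  have e0 : enorm y != 0%R.
    by apply/eqP => e0; apply: y0; rewrite -enorm2 e0 expr0n.
  rewrite (ge0_integral_affine 0%R e0)// ger0_norm ?enorm_ge0//.
  rewrite -ge0_integralZl//; last 2 first.
  - apply: (measurableT_comp (mfy y)).
    by apply: measurable_funD => //; exact: measurable_funM.
  - by rewrite lee_fin enorm_ge0.
  by apply: eq_integral => s _; rewrite /F2/= addr0 mulrC.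
rewrite fubini_tonelli//.
pose kf (y : n.+1.-tuple mR) : \bar R := (if in_ball (enorm y) then enorm y else 0%R)%:E.
have kf0 y : 0 <= kf y by rewrite lee_fin; case: ifP; rewrite // enorm_ge0.
have mkf : measurable_fun setT kf.
  apply/measurable_EFinP; apply: measurable_fun_ifT; [|exact: measurable_enorm|exact: measurable_cst].
  by apply: measurable_in_ball; exact: measurable_enorm.
have hr0 s : (0 <= h (tau s) * rho s ^+ n.+2)%R.
  by rewrite mulr_ge0 ?exprn_ge0 ?(ltW (rho_gt0 s))// h0//; have /andP[t1 t2] := tau_itv s; rewrite !ltW.
transitivity (\int[leb]_s (zonal_constant n.+1 * (h (tau s) * rho s ^+ n.+2)%:E)); last first.
  rewrite ge0_integralZl//.
  - apply/measurable_EFinP; apply: measurable_funM.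
      by apply: (measurableT_comp mh); exact: measurable_tau.
    by apply: measurable_funX; exact: measurable_rho.
  - by move=> s _; rewrite lee_fin.
  - by apply: lebesgue_int_ge0.
apply: eq_integral => s _.
have r0 := rho_gt0 s.
have h0s : (0 <= h (tau s))%R by rewrite h0//; have /andP[t1 t2] := tau_itv s; rewrite !ltW.
rewrite -ge0_lebesgue_intE//; last first.
  exact: (measurableT_comp mF2 (pair2_measurable s)).
(* Dilating [y] by [rho s] turns the norm of [x] into that of [y]. The dilation yields
   [rho s ^+ n.+1], and the Jacobian [enorm y] one more factor [rho s]. *)
rewrite (lebesgue_int_scale r0)//; last first.
  exact: (measurableT_comp mF2 (pair2_measurable s)).
transitivity ((rho s ^+ n.+1)%:E * @lebesgue_int R n.+1 (fun y => (rho s * h (tau s))%:E * kf y)).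
  congr (_ * _); apply: eq_lebesgue_int => y.
  rewrite /F2 /f /kf /nm/=.
  have eS : enorm (scalet (rho s) y) = (rho s * enorm y)%R.
    by rewrite /enorm dotp_scalel dotp_scaler mulrA -expr2 sqrtrM ?sqr_ge0// sqrtr_sqr gtr0_norm.
  have -> : Num.sqrt ((s * enorm (scalet (rho s) y)) ^+ 2 + dotp (scalet (rho s) y) (scalet (rho s) y)) = enorm y.
    rewrite -enorm2 eS -[RHS](ger0_norm (enorm_ge0 y)) -sqrtr_sqr; congr Num.sqrt.
    rewrite (_ : (_ + _)%R = (rho s ^+ 2 * (1 + s ^+ 2) * enorm y ^+ 2)%R); last by ring.
    by rewrite rho2D mul1r.
  rewrite eS -!EFinM; congr EFin; case: ifPn => [/andP[y0 _]|]; last by rewrite !mulr0.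
  rewrite mulrAC; congr (_ * _ * _)%R; congr h; rewrite /tau; field; exact: lt0r_neq0.
rewrite ge0_lebesgue_intE; last 2 first.
- by apply: emeasurable_funM => //; exact: measurable_cst.
- by move=> y; rewrite mule_ge0// lee_fin mulr_ge0// ltW.
rewrite ge0_integralZl//; last by rewrite lee_fin mulr_ge0// ltW.
rewrite -ge0_lebesgue_intE// muleA -EFinM muleC; congr (_ * _); congr EFin.
by rewrite [in RHS]exprSr; ring.
Qed.
End zonal.

(** * Integration over the sphere: linearity, positivity, rotations *)

Section sphere_calculus.
Variable R : realType.
Local Notation mR := (measurableTypeR R).
Local Notation leb := (@lebesgue_measure R).

Definition sphere_bounded n (g : n.-tuple mR -> R) : Prop :=
  measurable_fun setT (g : n.-tuple mR -> mR) /\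
  exists M : R, forall x, enorm x = 1 -> `|g x| <= M.

(** The integrand of [sphere_int]: [g] extended constantly along the rays of the punctured ball. *)
Definition cone n (g : n.-tuple mR -> R) (x : n.-tuple mR) : R :=
  if in_ball (enorm x) then g (normalize x) else 0.

Lemma normr_tnth_le_enorm n (x : n.-tuple R) i : `|tnth x i| <= enorm x.
Proof.
rewrite -sqrtr_sqr ler_sqrt ?dotp_ge0// /dotp (bigD1 i)//= -expr2 lerDl.
by apply: sumr_ge0 => j _; rewrite -expr2 sqr_ge0.
Qed.

Lemma dotp_normalize n (u x : n.-tuple R) : dotp u (normalize x) = dotp u x / enorm x.
Proof. by rewrite /dotp mulr_suml; apply: eq_bigr => i _; rewrite tnth_map mulrA. Qed.

Lemma enorm_normalize n (x : n.-tuple R) : 0 < enorm x -> enorm (normalize x) = 1.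
Proof.
move=> x0; rewrite {1}/enorm dotp_normalize dotpC dotp_normalize -enorm2.
by rewrite expr2 mulfK ?gt_eqF// divff ?gt_eqF// sqrtr1.
Qed.

Lemma measurable_cone n (g : n.-tuple mR -> R) :
  measurable_fun setT (g : _ -> mR) -> measurable_fun setT (cone g : _ -> mR).
Proof.
move=> mg; apply: measurable_fun_ifT; last exact: measurable_cst.
  by apply: measurable_in_ball; exact: measurable_enorm.
exact: (measurableT_comp mg (@measurable_normalize R n)).
Qed.

Lemma bounded_cone n (g : n.-tuple mR -> R) :
  sphere_bounded g -> bounded_in_cube (cone g).
Proof.
move=> [mg [M gM]]; split; first exact: measurable_cone.
exists `|M| => x; rewrite /cone; case: ifPn => [/andP[x0 x1]|_].
  have -> : in_cube x.
    by apply/all_tnthP => i; exact: le_trans (normr_tnth_le_enorm x i) x1.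
  by apply: (le_trans (gM _ (enorm_normalize x0))); exact: ler_norm.
by rewrite normr0; case: ifP.
Qed.

Lemma integrable_cone n (g : n.-tuple mR -> R) : sphere_bounded g ->
  (lebesgue_tuple R n).-integrable setT (EFin \o cone g).
Proof.
move=> /bounded_cone[mg [M gM]].
apply: (integrable_of_bounded (M := M) (@measurable_in_cube R n) (lebesgue_tuple_cube R n) mg).
by move=> x; rewrite mem_setE; exact: gM.
Qed.

(** Despite the name the surface measure is not normalised: this is the integral as a real
    number. *)
Definition sphere_mean n (g : n.-tuple mR -> R) : R := fine (sphere_int g).

Lemma sphere_intE n (g : n.-tuple mR -> R) : sphere_bounded g ->
  sphere_int g = (n%:R%:E * \int[lebesgue_tuple R n]_x (cone g x)%:E)%E.
Proof.
move=> bg; rewrite -bounded_lebesgue_intE; last exact: bounded_cone.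
congr (_ * _)%E; apply: eq_lebesgue_int => x /=.
by rewrite /cone /in_ball; case: ifP.
Qed.

Lemma sphere_meanE n (g : n.-tuple mR -> R) : sphere_bounded g ->
  sphere_int g = (sphere_mean g)%:E.
Proof.
move=> bg; rewrite /sphere_mean fineK// sphere_intE// fin_numM//.
exact: integrable_fin_num (integrable_cone bg).
Qed.

Lemma eq_sphere_int n (f g : n.-tuple R -> R) :
  (forall x, enorm x = 1 -> f x = g x) -> sphere_int f = sphere_int g.
Proof.
move=> fg; congr (_ * _)%E; apply: eq_lebesgue_int => x.
by case: ifPn => // /andP[x0 _]; rewrite fg// enorm_normalize.
Qed.

Lemma eq_sphere_mean n (f g : n.-tuple R -> R) :
  (forall x, enorm x = 1 -> f x = g x) -> sphere_mean f = sphere_mean g.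
Proof. by move=> fg; rewrite /sphere_mean (eq_sphere_int fg). Qed.

Lemma sphere_boundedD n (f g : n.-tuple mR -> R) (a b : R) :
  sphere_bounded f -> sphere_bounded g -> sphere_bounded (fun x => a * f x + b * g x).
Proof.
move=> [mf [M fM]] [mg [N gN]]; split.
  by apply: measurable_funD; apply: measurable_funM.
exists (`|a| * M + `|b| * N) => x x1; rewrite (le_trans (ler_normD _ _))// !normrM.
by apply: lerD; apply: ler_wpM2l; rewrite ?fM ?gN.
Qed.

Lemma sphere_boundedM n (f g : n.-tuple mR -> R) :
  sphere_bounded f -> sphere_bounded g -> sphere_bounded (fun x => f x * g x).
Proof.
move=> [mf [M fM]] [mg [N gN]]; split; first exact: measurable_funM.
by exists (M * N) => x x1; rewrite normrM ler_pM ?fM ?gN.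
Qed.

Lemma sphere_bounded_cst n (c : R) : sphere_bounded (fun _ : n.-tuple mR => c).
Proof. by split => //; exists `|c|. Qed.

Lemma sphere_bounded_tnth n i : sphere_bounded (fun x : n.-tuple mR => tnth x i : R).
Proof.
split; first exact: measurable_tnth.
by exists 1 => x x1; rewrite -x1 normr_tnth_le_enorm.
Qed.

(** Cauchy-Schwarz, by expanding the squared norms of [u + x] and [u - x]. *)
Lemma dotp_unit_itv n (u x : n.-tuple R) : enorm u = 1 -> enorm x = 1 -> -1 <= dotp u x <= 1.
Proof.
move=> u1 x1.
have uu : dotp u u = 1 by rewrite -enorm2 u1 expr1n.
have xx : dotp x x = 1 by rewrite -enorm2 x1 expr1n.
have E (e : R) : e ^+ 2 = 1 -> 0 <= 2 + 2 * e * dotp u x.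
  move=> e1; have : 0 <= \sum_(i < n) (tnth u i + e * tnth x i) ^+ 2.
    by apply: sumr_ge0 => i _; exact: sqr_ge0.
  suff -> : \sum_(i < n) (tnth u i + e * tnth x i) ^+ 2 = dotp u u + e ^+ 2 * dotp x x + 2 * e * dotp u x.
    by rewrite uu xx e1; lra.
  rewrite /dotp !mulr_sumr -!big_split/=; apply: eq_bigr => i _; ring.
have := E 1; have := E (-1); rewrite sqrrN expr1n => /(_ erefl) h1 /(_ erefl) h2.
by apply/andP; split; lra.
Qed.

Lemma sphere_bounded_dotp n (u : n.-tuple mR) : sphere_bounded (fun x : n.-tuple mR => dotp u x : R).
Proof.
split; first exact: measurable_dotp.
exists (\sum_(i < n) `|tnth u i|) => x x1; apply: (le_trans (ler_norm_sum _ _ _)).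
apply: ler_sum => i _; rewrite normrM ler_piMr// -x1; exact: normr_tnth_le_enorm.
Qed.

Lemma sphere_bounded_zonal n (u : n.-tuple mR) (h : mR -> R) : enorm u = 1 ->
  measurable_fun setT (h : mR -> mR) ->
  (exists M, forall t, -1 <= t <= 1 -> `|h t| <= M) ->
  sphere_bounded (fun x : n.-tuple mR => h (dotp u x)).
Proof.
move=> u1 mh [M hM]; split.
  by apply: (measurableT_comp mh); exact: measurable_dotp.
by exists M => x x1; apply: hM; exact: dotp_unit_itv.
Qed.

(** The single linearity rule: scalings and differences are instances of it, whence the explicit
    coefficients 1, - 1 and 0 further on. *)
Lemma sphere_meanD n (f g : n.-tuple mR -> R) (a b : R) :
  sphere_bounded f -> sphere_bounded g ->
  sphere_mean (fun x => a * f x + b * g x) = a * sphere_mean f + b * sphere_mean g.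
Proof.
move=> bf bg; have bD := sphere_boundedD a b bf bg.
apply: EFin_inj; rewrite EFinD !EFinM -!sphere_meanE// !sphere_intE//.
have iF := integrable_cone bf; have iG := integrable_cone bg.
have -> : (\int[lebesgue_tuple R n]_x (cone (fun x0 => a * f x0 + b * g x0) x)%:E =
  a%:E * \int[lebesgue_tuple R n]_x (cone f x)%:E + b%:E * \int[lebesgue_tuple R n]_x (cone g x)%:E)%E.
  rewrite -!integralZl// -integralD//; last 2 first.
    exact: integrableZl.
    exact: integrableZl.
  apply: eq_integral => x _; rewrite -!EFinM -EFinD; congr EFin.
  by rewrite /cone; case: ifP => // _; rewrite !mulr0 addr0.
have fF : (\int[lebesgue_tuple R n]_x (cone f x)%:E)%E \is a fin_num.
  exact: (integrable_fin_num measurableT iF).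
have fG : (\int[lebesgue_tuple R n]_x (cone g x)%:E)%E \is a fin_num.
  exact: (integrable_fin_num measurableT iG).
rewrite -(fineK fF) -(fineK fG); set F := fine _; set G := fine _.
have : n%:R * (a * F + b * G) = a * (n%:R * F) + b * (n%:R * G) by ring.
by move=> h; have := congr1 EFin h; rewrite EFinM EFinD !EFinM.
Qed.

Lemma sphere_mean_le n (f g : n.-tuple mR -> R) :
  sphere_bounded f -> sphere_bounded g ->
  (forall x, enorm x = 1 -> f x <= g x) -> sphere_mean f <= sphere_mean g.
Proof.
move=> bf bg fg; rewrite -lee_fin -!sphere_meanE// !sphere_intE//.
apply: lee_wpmul2l => //.
apply: le_integral => //; [exact: integrable_cone|exact: integrable_cone|].
move=> x _; rewrite lee_fin /cone; case: ifPn => // /andP[x0 _].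
by apply: fg; exact: enorm_normalize.
Qed.

Local Open Scope ereal_scope.

(** Open at 0, so that a nonempty-dimensional box avoids the origin. *)
Definition in_box n (e : R) (x : n.-tuple R) : bool :=
  all (fun a : R => (0 < a <= e)%R) x.

Lemma measurable_in_box n (e : R) :
  measurable_fun setT (fun x : n.-tuple mR => (in_box e x)%:R%R : mR).
Proof.
have mB : measurable [set x : n.-tuple mR | in_box e x].
  rewrite (_ : mkset _ = \bigcap_(i in [set: 'I_n])
      ((fun x : n.-tuple mR => tnth x i) @^-1` `]0%R, e]%classic)).
    apply: fin_bigcap_measurable => // i _.
    rewrite -[X in measurable X]setTI.
    exact: (@measurable_tnth _ mR n i measurableT _ (measurable_itv `]0%R, e])).
  apply/seteqP; split => x /=.
    by move=> /all_tnthP h i _; rewrite /= in_itv; exact: h.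
  by move=> h; apply/all_tnthP => i; have := h i I; rewrite /= in_itv.
rewrite (_ : (fun x => _) = \1_[set x : n.-tuple mR | in_box e x]).
  exact: measurable_indic.
by apply/funext => x; rewrite indicE mem_setE.
Qed.

Lemma lebesgue_int_box n (e : R) : (0 <= e)%R ->
  @lebesgue_int R n (fun x => (in_box e x)%:R%:E) = (e ^+ n)%:E.
Proof.
move=> e0; elim: n => [|n IH]; first by rewrite /= expr0.
rewrite lebesgue_intS.
transitivity (\int[leb]_a ((e ^+ n)%:E * (\1_(`]0%R, e]%classic : set mR) a)%:E)).
  apply: eq_integral => a _; rewrite indicE mem_setE.
  rewrite (_ : (a \in `]0%R, e]) = (0 < a <= e)%R); last by rewrite in_itv.
  case: (boolP (0 < a <= e)%R) => ha.
    rewrite mule1 -IH; apply: eq_lebesgue_int => t.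
    by rewrite /in_box /= ha.
  rewrite mule0; transitivity (@lebesgue_int R n (fun=> 0)).
    by apply: eq_lebesgue_int => t; rewrite /in_box /= (negbTE ha).
  elim: (n) => [//|m IHm]; rewrite lebesgue_intS.
  by apply: integral0_eq => x _; exact: IHm.
rewrite ge0_integralZl//; last 2 first.
- by apply/measurable_EFinP; exact: measurable_indic.
- by rewrite lee_fin exprn_ge0.
rewrite integral_indic// setIT.
have le : leb `]0%R, e]%classic = e%:E.
  rewrite lebesgue_measure_itv/= lte_fin.
  case: ltgtP e0 => // [e0 _|<- _]; last by [].
  by rewrite oppr0 adde0.
transitivity ((e ^+ n)%:E * leb `]0%R, e]%classic); first by [].
by rewrite le -EFinM -exprSr.
Qed.

(** The punctured unit ball contains a box of positive volume. With side [e = 1 / d], each square is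
    at most [e], so the [d] squares add up to at most 1. *)
Lemma sphere_mean1_gt0 n : (0 < sphere_mean (fun _ : n.+1.-tuple mR => 1))%R.
Proof.
have b1 := @sphere_bounded_cst n.+1 1%R.
rewrite -lte_fin -sphere_meanE//.
apply: mule_gt0; first by rewrite lte_fin ltr0n.
set e := (n.+1%:R^-1 : R)%R.
have e0 : (0 < e)%R by rewrite invr_gt0.
apply: (@lt_le_trans _ _ (@lebesgue_int R n.+1 (fun x => (in_box e x)%:R%:E))).
  by rewrite lebesgue_int_box ?ltW// lte_fin exprn_gt0.
have mb : measurable_fun setT (fun x : n.+1.-tuple mR => (in_box e x)%:R : mR).
  exact: measurable_in_box.
have mc : measurable_fun setT (cone (fun _ : n.+1.-tuple mR => 1%R) : _ -> mR).
  by apply: measurable_cone; exact: measurable_cst.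
rewrite [leRHS](@eq_lebesgue_int _ _ _ (fun x => (cone (fun _ : n.+1.-tuple mR => 1%R) x)%:E)); last first.
  by move=> x; rewrite /cone /in_ball; case: ifP.
have c0 x : (0 <= cone (fun _ : n.+1.-tuple mR => 1) x :> R)%R by rewrite /cone; case: ifP.
rewrite !ge0_lebesgue_intE//; try exact/measurable_EFinP.
apply: ge0_le_integral => //; try exact/measurable_EFinP.
move=> x _; rewrite lee_fin; case: (boolP (in_box e x)) => // xb.
rewrite /cone ifT// /in_ball.
have /all_tnthP xe := xb.
have nn (i : 'I_n.+1) : (0 < tnth x i <= e)%R by exact: xe.
rewrite sqrtr_gt0 -[X in (_ <= X)%R]sqrtr1 ler_sqrt//; apply/andP; split.
  rewrite /dotp (bigD1 ord0)//= ltr_pwDl//.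
    by have /andP[h _] := nn ord0; rewrite mulr_gt0.
  by apply: sumr_ge0 => i _; rewrite -expr2 sqr_ge0.
apply: (@le_trans _ _ (\sum_(i < n.+1) e)%R).
  apply: ler_sum => i _; have /andP[h1 h2] := nn i.
  have e1 : (e <= 1)%R by rewrite invf_le1// ler1n.
  by nra.
by rewrite sumr_const card_ord -[(e *+ _)%R]mulr_natl divff.
Qed.

(** One [be], the coefficient of [v] orthogonal to [mu], serves every [G]. The second equality is
    the reflection in the coordinate [x1], used later to eliminate terms odd in it. *)
Lemma sphere_int_rotation n (mu v : n.+2.-tuple R) : enorm mu = 1%R ->
  exists be : R, forall G : mR * mR -> R,
    measurable_fun setT (G : _ -> mR) -> (forall p, 0 <= G p)%R ->
    let x1 := lift ord0 ord0 : 'I_n.+2 in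
    sphere_int (fun x => G (dotp mu x, dotp v x)) =
    sphere_int (fun x : n.+2.-tuple R =>
      G (tnth x ord0, dotp v mu * tnth x ord0 + be * tnth x x1)%R) /\
    sphere_int (fun x : n.+2.-tuple R =>
      G (tnth x ord0, dotp v mu * tnth x ord0 + be * tnth x x1)%R) =
    sphere_int (fun x : n.+2.-tuple R =>
      G (tnth x ord0, dotp v mu * tnth x ord0 + - be * tnth x x1)%R).
Proof.
move=> mu1; have mumu : dotp mu mu = 1%R by rewrite -enorm2 mu1 expr1n.
have [be rot] := lebesgue_int_rotation v mumu.
exists be => G mG G0 x1; set al := dotp v mu in rot *.
(* The third argument is the squared norm, so that both the ball condition and the projection to the
   sphere depend only on quantities that the rotation lemma tracks. *)
pose H (p : mR * mR * mR) : \bar R := (if in_ball (Num.sqrt p.2) then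
  G (p.1.1 / Num.sqrt p.2, p.1.2 / Num.sqrt p.2)%R else 0%R)%:E.
have msq : measurable_fun setT (fun p : mR * mR * mR => Num.sqrt p.2 : mR).
  by apply: (measurableT_comp (@measurable_sqrtr R)); meas.
have mH : measurable_fun setT H.
  apply/measurable_EFinP; apply: measurable_fun_ifT; [exact: measurable_in_ball| |exact: measurable_cst].
  by apply: (measurableT_comp mG); meas; exact: measurable_funV.
have H0 p : 0 <= H p by rewrite lee_fin; case: ifP.
have sphereH (u w : n.+2.-tuple R) : sphere_int (fun x => G (dotp u x, dotp w x)) =
   (n.+2%:R)%:E * lebesgue_int (fun x => H (dotp u x, dotp w x, dotp x x)).
  congr (_ * _); apply: eq_lebesgue_int => x.
  by rewrite /H /= -/(enorm x) /in_ball !dotp_normalize; case: ifP.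
pose T (b : R) := \int[leb]_x \int[leb]_y @lebesgue_int R n (fun z =>
      H (x, al * x + b * y, x ^+ 2 + y ^+ 2 + dotp z z)%R).
have TE (b : R) : sphere_int (fun x : n.+2.-tuple R =>
      G (tnth x ord0, al * tnth x ord0 + b * tnth x x1)%R) = (n.+2%:R)%:E * T b.
  congr (_ * _); rewrite lebesgue_intS; apply: eq_integral => x _.
  rewrite lebesgue_intS; apply: eq_integral => y _; apply: eq_lebesgue_int => z.
  rewrite /H/= !tnth_map !tnth0 !tnthS !tnth0 !enorm_cons dotp_cons -expr2 addrA /in_ball.
  by case: ifP => // _; congr (G (_, _))%:E; ring.
split; first by rewrite TE sphereH rot.
rewrite !TE.
suff -> : T be = T (- be)%R by [].
apply: eq_integral => x _.
rewrite (ge0_integral_affine 0%R (c := (-1)%R)); last 3 first.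
- by rewrite oppr_eq0 oner_neq0.
- pose H2 (p : mR * n.-tuple mR) := H (x, al * x + be * p.1, x ^+ 2 + p.1 ^+ 2 + dotp p.2 p.2)%R.
  apply: (measurable_lebesgue_int (f := H2)); last by move=> p; exact: H0.
  by apply: (measurableT_comp mH); meas; apply: measurable_dotp; meas.
- by move=> y; apply: lebesgue_int_ge0 => z; exact: H0.
rewrite normrN1 mul1e; apply: eq_integral => y _; apply: eq_lebesgue_int => z.
by congr (H (_, _, _)); ring.
Qed.

Lemma tnth0_bounded (h : mR -> R) n : measurable_fun setT (h : mR -> mR) ->
  (exists M, forall t, -1 <= t <= 1 -> `|h t| <= M)%R ->
  sphere_bounded (fun x : n.+1.-tuple mR => h (tnth x ord0)).
Proof.
move=> mh [M hM]; split.
  by apply: (measurableT_comp mh); exact: measurable_tnth.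
by exists M => x x1; apply: hM; rewrite -ler_norml -x1 normr_tnth_le_enorm.
Qed.

Lemma normr_coef_tnth_le n (x : n.-tuple R) (a : R) i :
  enorm x = 1%R -> (`|a * tnth x i| <= `|a|)%R.
Proof.
by move=> x1; rewrite normrM ler_piMr// -x1 normr_tnth_le_enorm.
Qed.

(** The truncation at 0 makes the shifted integrand nonnegative on the whole plane; on the range
    attained over the sphere it changes nothing. *)
Let max_affine1 (M a b u : R) : (`|u| <= M ->
  Num.max 0 (M + `|a| + `|b| + u) = M + `|a| + `|b| + u)%R.
Proof.
move=> uM; apply: max_r.
by move: uM (normr_ge0 a) (normr_ge0 b); rewrite ler_norml => /andP[+ _]; lra.
Qed.

Let max_affine2 (M a b u w : R) : (0 <= M -> `|u| <= `|a| -> `|w| <= `|b| ->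
  Num.max 0 (M + `|a| + `|b| + (u + w)) = M + `|a| + `|b| + (u + w))%R.
Proof.
move=> M0 ua wb; apply: max_r.
by move: M0 ua wb; rewrite !ler_norml => M0 /andP[+ _] /andP[+ _]; lra.
Qed.

(** [G1 = G2] forces [be * B1 = 0], and the terms with [c] cancel by [A = A0]. *)
Let reflection_cancel (c al be A B A0 B0 B1 G G1 G2 : R) : (
  G = c * A + 1 * B -> G1 = c * A0 + 1 * (al * B0 + be * B1) ->
  G2 = c * A0 + 1 * (al * B0 + - be * B1) -> G = G1 -> G1 = G2 -> A = A0 ->
  B = al * B0)%R.
Proof. by move=> -> -> -> e1 e2 e3; rewrite e3 in e1; lra. Qed.

Section zonal_mean.
Variables (n : nat) (mu : n.+2.-tuple R) (h : mR -> R).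
Hypotheses (mu1 : enorm mu = 1%R) (mh : measurable_fun setT (h : mR -> mR)).
Hypotheses (h0 : forall t, (0 <= h t)%R)
  (hM : exists M, forall t, (-1 <= t <= 1 -> `|h t| <= M)%R).

Lemma sphere_int_zonalE :
  sphere_int (fun x => h (dotp mu x)) = sphere_int (fun x : n.+2.-tuple R => h (tnth x ord0)).
Proof.
have [be rot] := sphere_int_rotation mu mu1.
have [||-> _] // := rot (fun p => h p.1).
by apply: (measurableT_comp mh); meas.
Qed.

Local Open Scope ring_scope.

Lemma sphere_mean_zonalE :
  sphere_mean (fun x => h (dotp mu x)) = sphere_mean (fun x : n.+2.-tuple mR => h (tnth x ord0)).
Proof. by rewrite /sphere_mean sphere_int_zonalE. Qed.

(* Adding a large constant c makes the integrand nonnegative, as needed by the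
   Tonelli-based rotation lemma; the component of v orthogonal to mu
   contributes 0 because the reflection x_1 -> - x_1 changes its sign. *)
Lemma sphere_mean_zonal_dotp (v : n.+2.-tuple R) :
  sphere_mean (fun x => h (dotp mu x) * dotp v x) =
  dotp v mu * sphere_mean (fun x : n.+2.-tuple mR => h (tnth x ord0) * tnth x ord0).
Proof.
have [be rot] := sphere_int_rotation v mu1.
set al := dotp v mu in rot *.
have [bv [M vM]] := sphere_bounded_dotp v.
(* One shift for both sides: [M] bounds the product with [v] before the rotation, [|al| + |be|]
   bounds its rotated and reflected forms. *)
pose c := M + `|al| + `|be|.
pose x1 := lift ord0 ord0 : 'I_n.+2.
pose G (p : mR * mR) : R := h p.1 * Num.max 0 (c + p.2).
have mG : measurable_fun setT (G : _ -> mR).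
  apply: measurable_funM; first by apply: (measurableT_comp mh); meas.
  by apply: measurable_maxr; meas.
have G0 p : 0 <= G p by rewrite mulr_ge0// le_max lexx.
have M0 : 0 <= M by exact: le_trans (normr_ge0 _) (vM _ mu1).
have [E1 E2] := rot G mG G0; clear rot.
have bhm := sphere_bounded_zonal mu1 mh hM.
have bh := @tnth0_bounded h n.+1 mh hM.
have bt0 := @sphere_bounded_tnth n.+2 ord0.
have bt1 := @sphere_bounded_tnth n.+2 x1.
pose hmu (x : n.+2.-tuple mR) : R := h (dotp mu x).
pose hmuv (x : n.+2.-tuple mR) : R := h (dotp mu x) * dotp v x.
pose hx (x : n.+2.-tuple mR) : R := h (tnth x ord0).
pose hx0 (x : n.+2.-tuple mR) : R := h (tnth x ord0) * tnth x ord0.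
pose hx1 (x : n.+2.-tuple mR) : R := h (tnth x ord0) * tnth x x1.
have bht0 : sphere_bounded hx0 by exact: sphere_boundedM bh bt0.
have bht1 : sphere_bounded hx1 by exact: sphere_boundedM bh bt1.
have bhv : sphere_bounded hmuv by exact: sphere_boundedM bhm (sphere_bounded_dotp v).
have Ev : sphere_mean (fun x => G (dotp mu x, dotp v x)) =
    c * sphere_mean hmu + 1 * sphere_mean hmuv.
  transitivity (sphere_mean (fun x => c * hmu x + 1 * hmuv x)); last exact: sphere_meanD.
  apply: eq_sphere_mean => x x_1.
  by rewrite /G /c /= (max_affine1 _ _ (vM x x_1)) /hmu /hmuv; ring.
have Eb (b : R) : `|b| = `|be| ->
    sphere_mean (fun x : n.+2.-tuple R => G (tnth x ord0, al * tnth x ord0 + b * tnth x x1)) =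
    c * sphere_mean hx + 1 * (al * sphere_mean hx0 + b * sphere_mean hx1).
  move=> bbe.
  have b2 := sphere_boundedD al b bht0 bht1.
  transitivity (sphere_mean (fun x => c * hx x + 1 * (al * hx0 x + b * hx1 x))); last first.
    by rewrite (sphere_meanD c 1 bh b2) (sphere_meanD al b bht0 bht1).
  apply: eq_sphere_mean => x x_1.
  have t0 := normr_coef_tnth_le al ord0 x_1.
  have := normr_coef_tnth_le b x1 x_1; rewrite bbe => t1.
  by rewrite /G /c /= (max_affine2 M0 t0 t1) /hx /hx0 /hx1; ring.
have E3 : sphere_mean hmu = sphere_mean hx := sphere_mean_zonalE.
exact: (reflection_cancel Ev (Eb be erefl) (Eb (- be) (normrN be))
  (congr1 fine E1) (congr1 fine E2) E3).
Qed.

End zonal_mean.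

End sphere_calculus.

(** * Normalizer and first moment of the Power Spherical density *)

Lemma measurable_expRM (R : realType) (k : R) :
  measurable_fun setT ((fun t => expR (k * t)) : measurableTypeR R -> measurableTypeR R).
Proof.
have mk : measurable_fun setT ((fun t => k * t) : measurableTypeR R -> measurableTypeR R).
  exact: measurable_funM.
apply: (measurableT_comp (f := @expR R) _ mk).
exact: measurable_expR.
Qed.

(** One of the two bases is at least 1, and the other power is nonnegative. *)
Lemma powR_sym_ge1 (R : realType) (k t : R) : 0 <= k ->
  1 <= (1 + t) `^ k + (1 - t) `^ k.
Proof.
move=> k0; have ge1 (a : R) : 1 <= a -> 1 <= a `^ k.
  by move=> a1; rewrite -[leLHS](powRr0 a) ler_powR.
have [t0|t0] := leP 0 t.
  have := ge1 (1 + t); have := powR_ge0 (1 - t) k; rewrite lerDl t0; lra.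
have := ge1 (1 - t); have := powR_ge0 (1 + t) k.
by rewrite lerDl oppr_ge0 (ltW t0); lra.
Qed.

Lemma half_gt0 (R : realType) (a m z z1 z2 : R) :
  0 < a -> a <= m -> m = 1 * z1 + 1 * z2 -> z1 = z -> z2 = z -> 0 < z.
Proof. by move=> a0 am mE z1E z2E; lra. Qed.

Lemma normrM_onem_le (R : realType) (M u t : R) :
  `|u| <= M -> -1 <= t <= 1 -> `|u * (1 - t)| <= M * 2.
Proof.
move=> uM /andP[t1 t2]; rewrite normrM; apply: ler_pM => //.
by rewrite ger0_norm; lra.
Qed.

Lemma zonal_moment_solve (R : realType) (k m Z A M c : R) :
  ((k + m)%:E * A%:E = m%:E * Z%:E)%E -> A = 1 * Z + - 1 * M ->
  (k + m) * (c * M) = c * k * Z.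
Proof.
rewrite -!EFinM => -[e1 e2].
have e3 : (k + m) * M = k * Z by rewrite e2 in e1; lra.
by rewrite mulrCA e3 mulrA.
Qed.

Lemma mulr_onem_split (R : realType) (u t : R) : u * (1 - t) = 1 * u + - 1 * (u * t).
Proof. by ring. Qed.

Lemma measurable_onemM (R : realType) (h : measurableTypeR R -> measurableTypeR R) :
  measurable_fun setT h ->
  measurable_fun setT ((fun t => (h t : R) * (1 - t)) : measurableTypeR R -> measurableTypeR R).
Proof. by move=> mh; apply: measurable_funM => //; apply: measurable_funB. Qed.

Section power_spherical.
Variable R : realType.
Local Notation mR := (measurableTypeR R).
Variables (n : nat) (mu : n.+2.-tuple R) (k : R).
Hypotheses (mu1 : enorm mu = 1) (k0 : 0 <= k).

Let h (t : mR) : R := (1 + t) `^ k.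

Let h0 t : 0 <= h t. Proof. exact: powR_ge0. Qed.

Let mh : measurable_fun setT (h : mR -> mR).
Proof.
apply: (measurableT_comp (measurable_powR k)).
by apply: measurable_funD => //; exact: measurable_cst.
Qed.

Let h_le t : -1 <= t <= 1 -> `|h t| <= 2 `^ k.
Proof.
move=> /andP[t1 t2]; rewrite ger0_norm//.
by apply: ge0_ler_powR; rewrite ?nnegrE//; lra.
Qed.

Let hM : exists M, forall t, -1 <= t <= 1 -> `|h t| <= M.
Proof. by exists (2 `^ k) => t; exact: h_le. Qed.

Lemma sphere_bounded_power : sphere_bounded (fun x : n.+2.-tuple mR => (1 + dotp mu x) `^ k).
Proof. exact: (sphere_bounded_zonal mu1 mh hM). Qed.

Let normalizerE : ps_normalizer mu k =
  sphere_mean (fun x : n.+2.-tuple mR => h (tnth x ord0)).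
Proof. exact: sphere_mean_zonalE mu1 mh h0. Qed.

(* The normalizers of mu and -mu agree, and (1 + t)^k + (1 - t)^k >= 1. *)
Lemma ps_normalizer_gt0 : 0 < ps_normalizer mu k.
Proof.
have En (nu : n.+2.-tuple R) : enorm nu = 1 ->
    sphere_mean (fun x => h (dotp nu x)) = ps_normalizer mu k.
  by move=> nu1; rewrite normalizerE; exact (sphere_mean_zonalE nu1 mh h0).
have nu1 : enorm (scalet (- 1) mu) = 1.
  by rewrite /enorm dotp_scalel dotp_scaler -enorm2 mu1 expr1n !mulN1r opprK sqrtr1.
have bmu := sphere_bounded_power.
have bnu := sphere_bounded_zonal nu1 mh hM.
have b1 := @sphere_bounded_cst R n.+2 1.
have le1 : sphere_mean (fun _ : n.+2.-tuple mR => 1) <=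
    sphere_mean (fun x : n.+2.-tuple mR => 1 * (1 + dotp mu x) `^ k + 1 * h (dotp (scalet (- 1) mu) x)).
  apply: (sphere_mean_le b1 (sphere_boundedD 1 1 bmu bnu)) => x x1.
  rewrite !mul1r /h dotp_scalel mulN1r.
  exact: powR_sym_ge1.
exact (half_gt0 (sphere_mean1_gt0 R n.+1) le1 (sphere_meanD 1 1 bmu bnu)
  (En _ mu1) (En _ nu1)).
Qed.

Lemma ps_mean_dotp (v : n.+2.-tuple R) :
  (k + n.+1%:R) * sphere_mean (fun x => (1 + dotp mu x) `^ k * dotp v x) =
  dotp v mu * k * ps_normalizer mu k.
Proof.
rewrite (sphere_mean_zonal_dotp mu1 mh h0 hM) normalizerE.
(* The weight [1 - t] is nonnegative on [[-1, 1]], as the slicing formula requires; the moment is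
   recovered by subtraction from the normalizer. *)
pose hA (t : mR) : R := h t * (1 - t).
have mhA : measurable_fun setT (hA : mR -> mR).
  exact: measurable_onemM mh.
have hAM : exists M, forall t, -1 <= t <= 1 -> `|hA t| <= M.
  by exists (2 `^ k * 2) => t t1; exact (normrM_onem_le (h_le t1) t1).
have bA := @tnth0_bounded R hA n.+1 mhA hAM.
have bZ := @tnth0_bounded R h n.+1 mh hM.
have bT := sphere_boundedM bZ (@sphere_bounded_tnth R n.+2 ord0).
have EA : sphere_mean (fun x : n.+2.-tuple mR => hA (tnth x ord0)) =
    sphere_mean (fun x : n.+2.-tuple mR =>
      1 * h (tnth x ord0) + - 1 * (h (tnth x ord0) * tnth x ord0)).
  by apply: eq_sphere_mean => x _; exact: mulr_onem_split.
have hA0 t : -1 <= t <= 1 -> 0 <= hA t.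
  by move=> /andP[_ t1]; apply: mulr_ge0; [exact: h0|rewrite subr_ge0].
have E : ((k + n.+1%:R)%:E * sphere_int (fun x : n.+2.-tuple mR => hA (tnth x ord0)) =
        n.+1%:R%:E * sphere_int (fun x : n.+2.-tuple mR => h (tnth x ord0)))%E.
  rewrite (sphere_int_zonal n mhA hA0) (sphere_int_zonal n mh (fun t _ => h0 t)).
  rewrite muleCA [RHS]muleCA; congr (_ * _)%E.
  rewrite muleCA [RHS]muleCA; congr (_ * _)%E.
  exact (beta_identity n k0).
rewrite (sphere_meanE bA) (sphere_meanE bZ) in E.
exact (zonal_moment_solve _ E (etrans EA (sphere_meanD 1 (- 1) bZ bT))).
Qed.

End power_spherical.

(** * Finiteness of the entropy and assembly of the divergence *)

(** The bound [ln x <= x - 1], at [x] and at its inverse, encloses [x * ln x] between [x - 1] and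
    [x ^+ 2 - x]. The value 0 is included because the density vanishes opposite to its direction
    when the concentration is positive. *)
Lemma xlnx_bounded (R : realType) (M x : R) : 0 <= x <= M -> `|x * ln x| <= 1 + M ^+ 2.
Proof.
move=> /andP[x0 xM]; move: x0; rewrite le_eqVlt => /predU1P[<-|x0].
  by rewrite mul0r normr0 addr_ge0// sqr_ge0.
have l1 : ln x <= x - 1.
  have := @le_ln1Dx R (x - 1).
  by rewrite (_ : 1 + (x - 1) = x); [apply; lra|ring].
have xV0 : 0 < x^-1 by rewrite invr_gt0.
have l2 : - ln x <= x^-1 - 1.
  rewrite -lnV ?posrE//; have := @le_ln1Dx R (x^-1 - 1).
  by rewrite (_ : 1 + (x^-1 - 1) = x^-1); [apply; lra|ring].
have l3 : x * - ln x <= x * (x^-1 - 1) by rewrite ler_pM2l.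
rewrite mulrBr divff ?gt_eqF// in l3.
by rewrite ler_norml; apply/andP; split; nra.
Qed.

(** On the sphere the integrand is at least the constant [expR (- |k|)]. *)
Lemma vmf_normalizer_gt0 (R : realType) n (mu : n.+1.-tuple R) (k : R) :
  enorm mu = 1 -> 0 < vmf_normalizer mu k.
Proof.
move=> mu1.
have b1 := @sphere_bounded_cst R n.+1 (expR (- `|k|)).
have mE : measurable_fun setT ((fun t => expR (k * t)) : measurableTypeR R -> measurableTypeR R).
  exact: measurable_expRM.
have bE : sphere_bounded (fun x : n.+1.-tuple (measurableTypeR R) => expR (k * dotp mu x)).
  apply: (sphere_bounded_zonal mu1 mE); exists (expR `|k|) => t t1.
  rewrite ger0_norm ?expR_ge0// ler_expR (le_trans (ler_norm _))// normrM ler_piMr//.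
  by rewrite ler_norml.
apply: (@lt_le_trans _ _ (sphere_mean (fun _ : n.+1.-tuple (measurableTypeR R) => expR (- `|k|)))).
  have b0 := @sphere_bounded_cst R n.+1 1.
  rewrite (_ : (fun _ => _) = (fun x : n.+1.-tuple (measurableTypeR R) => expR (- `|k|) * 1 + 0 * 1)).
    by rewrite (sphere_meanD (expR (- `|k|)) 0 b0 b0) mul0r addr0 mulr_gt0 ?expR_gt0 ?sphere_mean1_gt0.
  by apply/funext => x; ring.
apply: (sphere_mean_le b1 bE) => x x1; rewrite ler_expR.
have := dotp_unit_itv mu1 x1; rewrite -ler_norml => t1.
have : `|k * dotp mu x| <= `|k| by rewrite normrM ler_piMr.
by rewrite ler_norml => /andP[].
Qed.

(** Bookkeeping in the reals: [F] is the divergence, [S] the integral of [p * ln p], [P] the mass of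
    [p], [D] its moment along [mu_q], [lc] the log-normalizer, [c] the product of the two
    directions, and [m = d - 1]. *)
Lemma kl_arith (R : realType) (F I S P D kq kp lc c m d : R) :
  0 < kp + m -> d = m + 1 -> F = 1 * I + lc * P -> I = 1 * S + - kq * D ->
  P = 1 -> (kp + m) * D = c * kp ->
  let al := (d - 1) / 2 + kp in let be := (d - 1) / 2 in
  F = S + lc - kq * c * ((al - be) / (al + be)).
Proof.
move=> km0 -> -> -> -> DE al be.
have -> : al - be = kp by rewrite /al /be; lra.
have -> : al + be = kp + m by rewrite /al /be; lra.
have -> : D = c * kp / (kp + m) by rewrite -DE mulrC mulKf// gt_eqF.
by field; rewrite gt_eqF.
Qed.

Lemma ln_vmf_density (R : realType) n (mu : n.-tuple R) (k : R) (x : n.-tuple R) :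
  0 < vmf_normalizer mu k ->
  ln (vmf_density mu k x) = k * dotp mu x - ln (vmf_normalizer mu k).
Proof. by move=> C0; rewrite /vmf_density ln_div ?posrE ?expR_gt0// expRK. Qed.

Lemma kl_integrand (R : realType) (p lp k t c : R) :
  p * (lp - (k * t - c)) = 1 * (1 * (p * lp) + - k * (p * t)) + c * p.
Proof. by ring. Qed.

Lemma sphere_bounded_xlnx (R : realType) n (p : n.-tuple (measurableTypeR R) -> R) :
  (forall x, 0 <= p x) -> sphere_bounded p ->
  sphere_bounded (fun x => p x * ln (p x)).
Proof.
move=> p0 [mp [M pM]]; split.
  apply: measurable_funM => //; apply: (measurableT_comp (f := @ln R) _ mp).
  exact: measurable_ln.
exists (1 + M ^+ 2) => x x1; apply: xlnx_bounded.
by rewrite p0/= -[leLHS](ger0_norm (p0 x)) pM.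
Qed.

Theorem theorem16 (R : realType) (d : nat) (hd : (2 <= d)%N)
    (mu_p mu_q : d.-tuple R) (kappa_p kappa_q : R)
    (hmup : enorm mu_p = 1) (hmuq : enorm mu_q = 1)
    (hkp : 0 <= kappa_p) (hkq : 0 <= kappa_q) :
  let alpha := (d%:R - 1) / 2 + kappa_p in
  let beta := (d%:R - 1) / 2 in
  kl_div (ps_density mu_p kappa_p) (vmf_density mu_q kappa_q)
  = (- entropy (ps_density mu_p kappa_p)
     + (ln (vmf_normalizer mu_q kappa_q))%:E
     - (kappa_q * dotp mu_q mu_p * ((alpha - beta) / (alpha + beta)))%:E)%E.
Proof.
case: d hd mu_p mu_q hmup hmuq => [|[|n]]// _ mu_p mu_q hmup hmuq alpha beta.
pose P (x : n.+2.-tuple R) := (1 + dotp mu_p x) `^ kappa_p.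
pose p : n.+2.-tuple R -> R := ps_density mu_p kappa_p.
pose Z := ps_normalizer mu_p kappa_p.
pose C := vmf_normalizer mu_q kappa_q.
have Z0 : 0 < Z := ps_normalizer_gt0 hmup hkp.
have C0 : 0 < C := vmf_normalizer_gt0 kappa_q hmuq.
have bP : sphere_bounded P := sphere_bounded_power hmup hkp.
have bd := sphere_bounded_dotp mu_q.
have bPd : sphere_bounded (fun x => P x * dotp mu_q x) := sphere_boundedM bP bd.
have bp : sphere_bounded p := sphere_boundedM bP (sphere_bounded_cst _ Z^-1).
have p0 x : 0 <= p x.
  by apply: mulr_ge0; [exact: powR_ge0|rewrite invr_ge0 (ltW Z0)].
have bplnp : sphere_bounded (fun x => p x * ln (p x)).
  exact: sphere_bounded_xlnx.
have bpd : sphere_bounded (fun x => p x * dotp mu_q x) := sphere_boundedM bp bd.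
have mean_p : sphere_mean p = 1.
  have -> : sphere_mean p = sphere_mean (fun x => Z^-1 * P x + 0 * P x).
    by apply: eq_sphere_mean => x _; rewrite /p /ps_density mul0r addr0 mulrC.
  rewrite (sphere_meanD Z^-1 0 bP bP) mul0r addr0.
  (* [Z] unfolds to the [sphere_mean] of [P]. *)
  exact (mulVf (lt0r_neq0 Z0)).
have kn0 : 0 < kappa_p + n.+1%:R by rewrite ltr_wpDl// ltr0Sn.
have mean_pd : (kappa_p + n.+1%:R) * sphere_mean (fun x => p x * dotp mu_q x) =
    dotp mu_q mu_p * kappa_p.
  have -> : sphere_mean (fun x => p x * dotp mu_q x) =
      sphere_mean (fun x => Z^-1 * (P x * dotp mu_q x) + 0 * (P x * dotp mu_q x)).
    apply: eq_sphere_mean => x _; rewrite /p /ps_density mul0r addr0.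
    by rewrite mulrAC mulrC.
  rewrite (sphere_meanD Z^-1 0 bPd bPd) mul0r addr0 mulrCA.
  have -> : (kappa_p + n.+1%:R) * sphere_mean (fun x => P x * dotp mu_q x) =
    dotp mu_q mu_p * kappa_p * Z := ps_mean_dotp hmup hkp mu_q.
  by rewrite mulrC (mulfK (lt0r_neq0 Z0)).
have bI := sphere_boundedD 1 (- kappa_q) bplnp bpd.
have bF := sphere_boundedD 1 (ln C) bI bp.
have -> : kl_div (ps_density mu_p kappa_p) (vmf_density mu_q kappa_q) =
    sphere_int (fun x => 1 * (1 * (p x * ln (p x)) + - kappa_q * (p x * dotp mu_q x)) + ln C * p x).
  apply: eq_sphere_int => x _; rewrite (ln_vmf_density x C0) -/p -/C.
  exact: kl_integrand.
have -> : entropy (ps_density mu_p kappa_p) = (- (sphere_mean (fun x => p x * ln (p x)))%:E)%E.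
  by rewrite -(sphere_meanE bplnp).
rewrite (sphere_meanE bF) oppeK.
exact (congr1 EFin (kl_arith kn0 (esym (natr1 _)) (sphere_meanD 1 (ln C) bI bp)
  (sphere_meanD 1 (- kappa_q) bplnp bpd) mean_p mean_pd)).
Qed.
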